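(* Let $\mathfrak g$ be a complex Lie superalgebra, $\mathfrak p$ a ($\mathbb Z_2$-graded) ideal of $\mathfrak g$, and $\phi\colon\mathfrak p\to\mathbb C$ a Lie superalgebra homomorphism. There exists a bland quasi-Whittaker $\mathfrak g$-supermodule of type $\phi$ if and only if $\phi$ is extendable. In this case, the correspondence $\phi'\mapsto V(\phi')$ gives a bijection between the extensions $\phi'\colon\mathfrak g^\phi\to\mathbb C$ of $\phi$ and the isomorphism classes, up to parity shift, of bland irreducible quasi-Whittaker $\mathfrak g$-supermodules of type $\phi$.
   Context: All Lie superalgebras and supermodules are over $\mathbb C$, of arbitrary dimension; $\mathbb C$ is regarded as a purely even abelian Lie superalgebra. Irreducible means having no nonzero proper ($\mathbb Z_2$-graded) subsupermodule. The Whittaker annihilator of $\phi$ is $\mathfrak g^\phi=\{y\in\mathfrak g\mid \phi([y,p])=0\ \forall p\in\mathfrak p\}$; it is a graded subalgebra containing $\mathfrak p$. For a $\mathfrak g$-supermodule $V$, $V_\phi=\{v\in V\mid pv=\phi(p)v\ \forall p\in\mathfrak p\}$ is the space of quasi-Whittaker vectors of type $\phi$; $V$ is a quasi-Whittaker supermodule of type $\phi$ if it is generated by a homogeneous element of $V_\phi$. An irreducible quasi-Whittaker supermodule $V$ of type $\phi$ is called bland if $\dim V_\phi=1$. The homomorphism $\phi$ is extendable if it extends to a Lie superalgebra homomorphism $\phi'\colon\mathfrak g^\phi\to\mathbb C$ (an extension of $\phi$). For such $\phi'$, let $\mathbb C v_{\phi'}$ be the one-dimensional $\mathfrak g^\phi$-supermodule,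 with $v_{\phi'}$ even, given by $yv_{\phi'}=\phi'(y)v_{\phi'}$ for $y\in\mathfrak g^\phi$, and set $V(\phi')=\mathrm{Ind}_{\mathfrak g^\phi}^{\mathfrak g}\mathbb C v_{\phi'}=\mathcal U(\mathfrak g)\otimes_{\mathcal U(\mathfrak g^\phi)}\mathbb C v_{\phi'}$. ''Up to parity shift'' means that a supermodule and its parity shift are identified. *)

(* Defs.v *)
From HB Require Import structures.
From mathcomp Require Import all_boot all_order all_algebra generic_quotient.
From mathcomp Require Import ring_quotient boolp finmap monalg.

Set Implicit Arguments.
Unset Strict Implicit.
Unset Printing Implicit Defensive.

Import GRing.Theory Num.Theory.
Local Open Scope ring_scope.
Local Open Scope quotient_scope.

Record subspace (K : pzRingType) (V : lmodType K) := Subspace {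
  subspace_pred :> {pred V};
  subspace_closed : submod_closed subspace_pred
}.

HB.instance Definition _ (K : pzRingType) (V : lmodType K) (S : subspace V) :=
  GRing.isSubmodClosed.Build K V (subspace_pred S) (subspace_closed S).

Lemma subspaceZD (K : pzRingType) (V : lmodType K) (S : subspace V) c u v :
  u \in S -> v \in S -> c *: u + v \in S.
Proof. by move=> uS vS; rewrite rpredD ?rpredZ. Qed.

Section SubspaceOfProp.
Variables (K : pzRingType) (V : lmodType K) (P : V -> Prop).
Hypothesis P0 : P 0.
Hypothesis PZD : forall c u v, P u -> P v -> P (c *: u + v).

Lemma prop_submod_closed : submod_closed (fun v => `[< P v >]).
Proof.
split; first exact/asboolP.
by move=> c u v /asboolP Pu /asboolP Pv; apply/asboolP/PZD.
Qed.

Definition subspace_of : subspace V := Subspace prop_submod_closed.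

Lemma subspace_ofP v : reflect (P v) (v \in subspace_of).
Proof. exact: asboolP. Qed.
End SubspaceOfProp.

Section Span.
Variables (K : pzRingType) (V : lmodType K).

Definition in_span (X : V -> Prop) (v : V) :=
  forall S : subspace V, (forall x, X x -> x \in S) -> v \in S.

Lemma in_span0 X : in_span X 0.
Proof. by move=> S _; exact: rpred0. Qed.

Lemma in_spanZD X c u v : in_span X u -> in_span X v -> in_span X (c *: u + v).
Proof. by move=> Xu Xv S XS; rewrite rpredD ?rpredZ ?Xu ?Xv. Qed.

Definition span (X : V -> Prop) : subspace V :=
  subspace_of (@in_span0 X) (@in_spanZD X).

Lemma span_gen (X : V -> Prop) x : X x -> x \in span X.
Proof. by move=> Xx; apply/subspace_ofP => S; apply. Qed.

Lemma span_ind (X : V -> Prop) (P : V -> Prop) :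
  P 0 -> (forall c u v, P u -> P v -> P (c *: u + v)) ->
  (forall x, X x -> P x) -> forall v, v \in span X -> P v.
Proof.
move=> P0 PZD XP v /subspace_ofP/(_ (subspace_of P0 PZD)) vP.
by apply/(subspace_ofP P0 PZD)/vP => x /XP Px; exact/subspace_ofP.
Qed.
End Span.

(* Several operations below are locked with this key, to keep unification from
   unfolding quotients and free modules. *)
Fact opaque_key : unit. Proof. exact: tt. Qed.

Section LmodQuot.
Variables (K : pzRingType) (V : lmodType K) (S : subspace V).

Definition lquot : Type := Quotient.quot (subspace_pred S).
HB.instance Definition _ := GRing.Zmodule.on lquot.

Definition lproj : V -> lquot :=
  locked_with opaque_key (fun v => \pi_(Quotient.quot (subspace_pred S)) v).
Definition lrepr : lquot -> V :=
  locked_with opaque_key (fun q : Quotient.quot (subspace_pred S) => repr q).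

Lemma lreprK : cancel lrepr lproj.
Proof. by rewrite /lrepr /lproj !locked_withE; exact: reprK. Qed.

Lemma lproj_eq u v : (lproj u == lproj v) = (u - v \in S).
Proof. by rewrite /lproj locked_withE -Quotient.idealrBE. Qed.

Lemma lprojP u v : lproj u = lproj v <-> u - v \in S.
Proof. by rewrite -lproj_eq; split => /eqP. Qed.

Lemma lrepr_proj v : lrepr (lproj v) - v \in S.
Proof. by rewrite -lproj_eq lreprK. Qed.

Lemma lprojD : {morph lproj : u v / u + v}.
Proof. by move=> u v; rewrite /lproj locked_withE piE. Qed.

Definition lquot_scale : K -> lquot -> lquot :=
  locked_with opaque_key (fun c q => lproj (c *: lrepr q)).

Lemma lprojZ c v : lproj (c *: v) = lquot_scale c (lproj v).
Proof.
by rewrite /lquot_scale locked_withE; apply/esym/lprojP; rewrite -scalerBr rpredZ ?lrepr_proj.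
Qed.

Lemma lquot_scaleA a b q :
  lquot_scale a (lquot_scale b q) = lquot_scale (a * b) q.
Proof. by rewrite -[q]lreprK -!lprojZ scalerA. Qed.
Lemma lquot_scale1 : left_id 1 lquot_scale.
Proof. by move=> q; rewrite -[q]lreprK -!lprojZ scale1r. Qed.
Lemma lquot_scaleDr : right_distributive lquot_scale +%R.
Proof.
by move=> c q r; rewrite -[q]lreprK -[r]lreprK -lprojD -!lprojZ -lprojD scalerDr.
Qed.
Lemma lquot_scaleDl q : {morph lquot_scale^~ q : a b / a + b}.
Proof. by move=> a b; rewrite -[q]lreprK -!lprojZ -lprojD scalerDl. Qed.

HB.instance Definition _ := GRing.Zmodule_isLmodule.Build K lquot
  lquot_scaleA lquot_scale1 lquot_scaleDr lquot_scaleDl.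

Lemma lproj_is_linear : linear lproj.
Proof. by move=> c u v; rewrite lprojD lprojZ. Qed.
HB.instance Definition _ := GRing.isLinear.Build K V lquot _ lproj
  lproj_is_linear.

Lemma lproj0P v : lproj v = 0 <-> v \in S.
Proof. by rewrite -[0](linear0 lproj) lprojP subr0. Qed.

Lemma lift_lproj (W : lmodType K) (f : {linear V -> W}) :
  (forall v, v \in S -> f v = 0) -> forall v, f (lrepr (lproj v)) = f v.
Proof.
by move=> fS v; apply/eqP; rewrite -subr_eq0 -linearB fS // lrepr_proj.
Qed.
End LmodQuot.

Section FreeLmod.
Variables (K : numFieldType) (X : choiceType).

Lemma malg_ind (P : {malg K[X]} -> Prop) :
  P 0 -> (forall c u v, P u -> P v -> P (c *: u + v)) ->
  (forall k, P << k >>) -> forall p, P p.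
Proof.
move=> P0 PZD PU p; rewrite [p]monalgE; elim/big_ind: _ => //.
  by move=> u v Pu Pv; rewrite -[u]scale1r; exact: PZD.
move=> k _; have -> : << p@_k *g k >> = p@_k *: << k >> + 0.
  by apply/malgP => k'; rewrite addr0 mcoeffZ !mcoeffU mulrnAr mulr1.
exact: PZD.
Qed.

Variables (W : lmodType K) (F : X -> W).

Definition free_lift (p : {malg K[X]}) : W := \sum_(k <- msupp p) p@_k *: F k.

Lemma free_liftEw (d : {fset X}) p : (msupp p `<=` d)%fset ->
  free_lift p = \sum_(k <- d) p@_k *: F k.
Proof.
move=> le; rewrite /free_lift (big_fset_incl _ le) // => k _ /mcoeff_outdom ->.
by rewrite scale0r.
Qed.

Lemma free_lift_is_linear : linear free_lift.
Proof.
move=> c p q; pose d := (msupp p `|` msupp q `|` msupp (c *: p + q))%fset.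
rewrite !(@free_liftEw d) ?fsubsetUr //; first last.
- by rewrite /d -fsetUA fsubsetUl.
- by rewrite /d fsetUAC fsubsetUr.
rewrite scaler_sumr -big_split /=; apply: eq_bigr => k _.
by rewrite mcoeffD mcoeffZ scalerDl scalerA.
Qed.
HB.instance Definition _ :=
  GRing.isLinear.Build K {malg K[X]} W _ free_lift free_lift_is_linear.

Lemma free_liftU k : free_lift << k >> = F k.
Proof.
rewrite (@free_liftEw [fset k]%fset) ?msuppU_le // big_seq_fset1 mcoeffUU.
exact: scale1r.
Qed.
End FreeLmod.

Lemma malg_scaleAr (K : numFieldType) (M : monomType) c (p q : {malg K[M]}) :
  c *: (p * q) = p * (c *: q).
Proof.
apply/malgP => k; rewrite mcoeffZ.
rewrite (mcoeffMlw _ (fsubset_refl (msupp p)) (fsubset_refl (msupp q))).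
rewrite (mcoeffMlw _ (fsubset_refl (msupp p)) (msuppZ_le c q)).
rewrite mulr_sumr; apply: eq_bigr => i _; rewrite mulr_sumr.
by apply: eq_bigr => j _; rewrite mcoeffZ mulrnAr mulrCA.
Qed.

Lemma malgUM (K : numFieldType) (M : monomType) (k l : M) :
  << k >> * << l >> = << mmul k l >> :> {malg K[M]}.
Proof. by rewrite malgM_def fgmulUU mulr1. Qed.

Lemma malg_mullin (K : numFieldType) (M : monomType) c (p q r : {malg K[M]}) :
  (c *: p + q) * r = c *: (p * r) + q * r.
Proof. by rewrite mulrDl -(scalerAl c p r). Qed.

Lemma malg_mulrin (K : numFieldType) (M : monomType) c (p q r : {malg K[M]}) :
  r * (c *: p + q) = c *: (r * p) + r * q.
Proof. by rewrite mulrDr -(malg_scaleAr c r p). Qed.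

Lemma addr_shuffle (V : zmodType) (a b c d : V) :
  a + b + (c + d) = a + d + (b + c).
Proof. by rewrite [c + d]addrC addrACA. Qed.

(* Parities are booleans, [false] being even; V_a is [comp V a]. *)
Record superspace (K : numFieldType) := Superspace {
  superspace_sort :> lmodType K;
  comp : bool -> subspace superspace_sort;
  comp_cover : forall v, exists v0 v1,
    [/\ v0 \in comp false, v1 \in comp true & v = v0 + v1];
  comp_direct : forall v, v \in comp false -> v \in comp true -> v = 0
}.
Arguments comp {K} V a : rename.

Definition graded (K : numFieldType) (V : superspace K) (S : subspace V) :=
  forall v, v \in S -> exists v0 v1,
    [/\ v0 \in S, v1 \in S, v0 \in comp V false, v1 \in comp V true
      & v = v0 + v1].

Definition ssign (K : numFieldType) (a b : bool) : K := (-1) ^+ (a && b).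
Arguments ssign {K} a b.

Record lieSuperalgebra (K : numFieldType) := LieSuperalgebra {
  lsa_space :> superspace K;
  br : lsa_space -> lsa_space -> lsa_space;
  br_linl : forall y, linear (br^~ y);
  br_linr : forall x, linear (br x);
  br_even : forall a b x y, x \in comp lsa_space a -> y \in comp lsa_space b ->
    br x y \in comp lsa_space (a (+) b);
  br_skew : forall a b x y, x \in comp lsa_space a -> y \in comp lsa_space b ->
    br x y = - (ssign a b *: br y x);
  br_jacobi : forall a b c x y z, x \in comp lsa_space a ->
    y \in comp lsa_space b -> z \in comp lsa_space c ->
    br x (br y z) = br (br x y) z + ssign a b *: br y (br x z)
}.

Record lsaHom (K : numFieldType) (g h : lieSuperalgebra K) := LsaHom {
  lsaHom_fun :> {linear g -> h};
  lsaHom_even : forall a x, x \in comp g a -> lsaHom_fun x \in comp h a;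
  lsaHom_br : forall x y, lsaHom_fun (br x y) = br (lsaHom_fun x) (lsaHom_fun y)
}.

Record supermodule (K : numFieldType) (g : lieSuperalgebra K) := Supermodule {
  smod_space :> superspace K;
  act : g -> smod_space -> smod_space;
  act_linl : forall v, linear (act^~ v);
  act_linr : forall x, linear (act x);
  act_even : forall a b x v, x \in comp g a -> v \in comp smod_space b ->
    act x v \in comp smod_space (a (+) b);
  act_br : forall a b x y v, x \in comp g a -> y \in comp g b ->
    act (br x y) v = act x (act y v) - ssign a b *: act y (act x v)
}.

Section Superspace.
Variables (K : numFieldType) (V : superspace K).

Lemma comp_uniq (u0 u1 v0 v1 : V) :
  u0 \in comp V false -> u1 \in comp V true ->
  v0 \in comp V false -> v1 \in comp V true ->
  u0 + u1 = v0 + v1 -> u0 = v0 /\ u1 = v1.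
Proof.
move=> u0V u1V v0V v1V e.
have e' : u0 - v0 = v1 - u1.
  by apply/eqP; rewrite subr_eq addrAC -subr_eq opprK e addrC.
have d0 : u0 - v0 = 0.
  by apply: comp_direct; [rewrite rpredB | rewrite e' rpredB].
split; apply/eqP; rewrite -subr_eq0 ?d0 //.
by rewrite -opprB -e' d0 oppr0.
Qed.

Definition even_part (v : V) : V := projT1 (cid (comp_cover v)).

(* The parity involution v0 + v1 |-> v0 - v1. *)
Definition pinv (v : V) : V := even_part v *+ 2 - v.

Lemma pinvE v0 v1 : v0 \in comp V false -> v1 \in comp V true ->
  pinv (v0 + v1) = v0 - v1.
Proof.
move=> v0V v1V; rewrite /pinv /even_part; case: cid => u0 /= [u1 [u0V u1V e]].
have [<- _] := comp_uniq v0V v1V u0V u1V e.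
by rewrite mulr2n opprD addrACA subrr add0r.
Qed.

Lemma pinv_comp a v : v \in comp V a -> pinv v = (-1) ^+ a *: v.
Proof.
case: a => vV; first by rewrite -[v in LHS]add0r pinvE ?rpred0 // sub0r scaleN1r.
by rewrite -[v in LHS]addr0 pinvE ?rpred0 // subr0 scale1r.
Qed.

Lemma pinv_is_linear : linear pinv.
Proof.
move=> c u v.
have [u0 [u1 [u0V u1V ->]]] := comp_cover u.
have [v0 [v1 [v0V v1V ->]]] := comp_cover v.
rewrite scalerDr addrACA !pinvE ?rpredD ?rpredZ //.
by rewrite opprD addrACA scalerBr.
Qed.
HB.instance Definition _ := GRing.isLinear.Build K V V _ pinv pinv_is_linear.

Lemma comp_ind (P : V -> Prop) :
  (forall u v, P u -> P v -> P (u + v)) ->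
  (forall a v, v \in comp V a -> P v) -> forall v, P v.
Proof.
move=> PD PV v; have [v0 [v1 [v0V v1V ->]]] := comp_cover v.
by apply: PD; [exact: (PV false) | exact: (PV true)].
Qed.
End Superspace.


Section LinearHelpers.
Variables (K : pzRingType) (V W : lmodType K) (f : V -> W).
Hypothesis lf : linear f.
Definition linear_pack : {linear V -> W} :=
  HB.pack f (GRing.isLinear.Build K V W _ f lf).
Lemma linearfD : {morph f : x y / x + y}.
Proof. exact: (linearD linear_pack). Qed.
Lemma linearfN : {morph f : x / - x}.
Proof. exact: (linearN linear_pack). Qed.
Lemma linearfZ c : {morph f : x / c *: x}.
Proof. by move=> x; exact: scalable_linear. Qed.
Lemma linearf0 : f 0 = 0.
Proof. exact: (linear0 linear_pack). Qed.
End LinearHelpers.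

Lemma pinv_bilin (K : numFieldType) (U V W : superspace K) (f : U -> V -> W) :
  (forall y, linear (f^~ y)) -> (forall x, linear (f x)) ->
  (forall a b x y, x \in comp U a -> y \in comp V b ->
     f x y \in comp W (a (+) b)) ->
  forall x y, pinv (f x y) = f (pinv x) (pinv y).
Proof.
move=> fl fr fe x y; elim/comp_ind: x => [u v IHu IHv|a x xU].
  by rewrite (linearfD (fl y)) !linearD /= (linearfD (fl _)) IHu IHv.
elim/comp_ind: y => [u v IHu IHv|b y yV].
  by rewrite (linearfD (fr x)) !linearD /= (linearfD (fr _)) IHu IHv.
rewrite (pinv_comp xU) (pinv_comp yV) (pinv_comp (fe _ _ _ _ xU yV)).
rewrite (linearfZ (fl _)) (linearfZ (fr _)) scalerA -signr_addb.
by [].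
Qed.

#[local] Obligation Tactic := idtac.

(* C as a purely even abelian Lie superalgebra. *)
Section Trivial.
Variable K : numFieldType.

Definition even_comp (a : bool) : subspace K^o :=
  if a then @subspace_of K K^o (fun v => v = 0) erefl
              (fun c u v (u0 : u = 0) (v0 : v = 0) => ltac:(by rewrite u0 v0 scaler0 addr0))
  else @subspace_of K K^o (fun=> True) I (fun _ _ _ _ _ => I).

Lemma even_comp0 v : v \in even_comp false.
Proof. exact/asboolP. Qed.
Lemma even_comp1 v : (v \in even_comp true) = (v == 0).
Proof. by apply/asboolP/eqP. Qed.

Lemma even_cover v : exists v0 v1,
  [/\ v0 \in even_comp false, v1 \in even_comp true & v = v0 + v1].
Proof. by exists v, 0; rewrite even_comp0 even_comp1 addr0. Qed.

Lemma even_direct v : v \in even_comp false -> v \in even_comp true -> v = 0.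
Proof. by rewrite even_comp1 => _ /eqP. Qed.

Definition even_line : superspace K := Superspace even_cover even_direct.

Program Definition scalar_lsa : lieSuperalgebra K :=
  @LieSuperalgebra K even_line (fun _ _ => 0) _ _ _ _ _.
Next Obligation. by move=> y c x x'; rewrite scaler0 addr0. Qed.
Next Obligation. by move=> x c y y'; rewrite scaler0 addr0. Qed.
Next Obligation. by move=> *; rewrite rpred0. Qed.
Next Obligation. by move=> *; rewrite scaler0 oppr0. Qed.
Next Obligation. by move=> *; rewrite scaler0 addr0. Qed.
End Trivial.

Section OneDim.
Variables (K : numFieldType) (h : lieSuperalgebra K) (chi : lsaHom h (scalar_lsa K)).

Lemma chi_odd x : x \in comp h true -> chi x = 0.
Proof. by move=> /(lsaHom_even chi); rewrite [_ \in _]even_comp1 => /eqP. Qed.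

Definition one_dim_act (x : h) (v : even_line K) : even_line K :=
  (chi x : K) *: v.

Lemma one_dim_act_even a b x v : x \in comp h a -> v \in comp (even_line K) b ->
  one_dim_act x v \in comp (even_line K) (a (+) b).
Proof.
rewrite /one_dim_act; case: a => xh; first by rewrite chi_odd // scale0r rpred0.
by move=> vb; rewrite rpredZ.
Qed.

Lemma one_dim_act_br a b x y v : x \in comp h a -> y \in comp h b ->
  one_dim_act (br x y) v = one_dim_act x (one_dim_act y v)
    - ssign a b *: one_dim_act y (one_dim_act x v).
Proof.
rewrite /one_dim_act => xa yb; rewrite lsaHom_br scale0r.
case: a xa => xa; first by rewrite (chi_odd xa) !(scale0r, scaler0) subr0.
by rewrite scale1r !scalerA mulrC subrr.
Qed.

Program Definition one_dim : supermodule h :=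
  @Supermodule K h (even_line K) one_dim_act _ _ one_dim_act_even
    one_dim_act_br.
Next Obligation.
by move=> v c x y; rewrite /one_dim_act linearP scalerDl scalerA.
Qed.
Next Obligation.
by move=> x c u v; rewrite /one_dim_act scalerDr !scalerA mulrC.
Qed.
End OneDim.

Section Subalgebras.
Variables (K : numFieldType) (g : lieSuperalgebra K).

Record gradedSubalgebra := GradedSubalgebra {
  subalg_space :> subspace g;
  subalg_graded : graded subalg_space;
  subalg_br : forall x y, x \in subalg_space -> y \in subalg_space ->
    br x y \in subalg_space
}.

Record gradedIdeal := GradedIdeal {
  ideal_space : subspace g;
  ideal_graded : graded ideal_space;
  ideal_br : forall x y, y \in ideal_space -> br x y \in ideal_space
}.

Definition subalg_of_ideal (p : gradedIdeal) : gradedSubalgebra :=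
  GradedSubalgebra (@ideal_graded p) (fun x y _ => @ideal_br p x y).

Variable h : gradedSubalgebra.

Definition subalg_sort : Type := {x : g | x \in subspace_pred h}.
HB.instance Definition _ := SubChoice.on subalg_sort.
HB.instance Definition _ := [SubChoice_isSubLmodule of subalg_sort by <:].

Definition subalg_comp_closed a :
  submod_closed (fun x : subalg_sort => val x \in comp g a).
Proof.
split=> [|c x y xa ya]; first exact: rpred0.
by apply: rpredD => //; exact: rpredZ.
Qed.
Definition subalg_comp a : subspace subalg_sort :=
  Subspace (subalg_comp_closed a).

Lemma subalg_cover x : exists x0 x1,
  [/\ x0 \in subalg_comp false, x1 \in subalg_comp true & x = x0 + x1].
Proof.
have [x0 [x1 [x0h x1h x0g x1g e]]] := subalg_graded (valP x).
by exists (Sub x0 x0h), (Sub x1 x1h); split=> //; apply: val_inj.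
Qed.

Lemma subalg_direct x :
  x \in subalg_comp false -> x \in subalg_comp true -> x = 0.
Proof. by move=> x0 x1; apply: val_inj; apply: comp_direct x0 x1. Qed.

Definition subalg_superspace : superspace K :=
  Superspace subalg_cover subalg_direct.

Definition subalg_bracket (x y : subalg_sort) : subalg_sort :=
  Sub (br (val x) (val y)) (subalg_br (valP x) (valP y)).

Program Definition lsa_of_subalg : lieSuperalgebra K :=
  @LieSuperalgebra K subalg_superspace subalg_bracket _ _ _ _ _.
Next Obligation.
by move=> y c x x'; apply: val_inj; exact: br_linl.
Qed.
Next Obligation.
by move=> x c y y'; apply: val_inj; exact: br_linr.
Qed.
Next Obligation. by move=> a b x y; exact: br_even. Qed.
Next Obligation.
by move=> a b x y xa yb; apply: val_inj; exact: br_skew xa yb.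
Qed.
Next Obligation.
by move=> a b c x y z xa yb zc; apply: val_inj; exact: br_jacobi xa yb zc.
Qed.
End Subalgebras.
Coercion subalg_of_ideal : gradedIdeal >-> gradedSubalgebra.
Coercion lsa_of_subalg : gradedSubalgebra >-> lieSuperalgebra.

Section WhittakerAnnihilator.
Variables (K : numFieldType) (g : lieSuperalgebra K) (p : gradedIdeal g).
Variable phi : lsaHom p (scalar_lsa K).

Definition ideal_bracket (y : g) (q : p) : p :=
  Sub (br y (val q)) (ideal_br y (valP q)).

Lemma ideal_bracket_linl q : linear (ideal_bracket^~ q).
Proof. by move=> c x y; apply: val_inj; exact: br_linl. Qed.
Lemma ideal_bracket_linr y : linear (ideal_bracket y).
Proof. by move=> c q r; apply: val_inj; exact: br_linr. Qed.

Definition in_annihilator (y : g) := forall q : p, phi (ideal_bracket y q) = 0.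

Lemma annihilator_closed : submod_closed (fun y => `[< in_annihilator y >]).
Proof.
split=> [|c x y /asboolP xA /asboolP yA]; apply/asboolP => q.
  by rewrite (linearf0 (ideal_bracket_linl q)) linear0.
by rewrite ideal_bracket_linl linearP xA yA scaler0 addr0.
Qed.

Definition annihilator_space : subspace g := Subspace annihilator_closed.

Lemma annihilatorP y : reflect (in_annihilator y) (y \in annihilator_space).
Proof. exact: asboolP. Qed.

Lemma annihilator_graded : graded annihilator_space.
Proof.
move=> y /annihilatorP yA; have [y0 [y1 [y0g y1g e]]] := comp_cover y.
have phiE q : phi (ideal_bracket y q) =
    phi (ideal_bracket y0 q) + phi (ideal_bracket y1 q).
  by rewrite e (linearfD (ideal_bracket_linl q)) linearD.
have br_comp a b x q : x \in comp g a -> q \in comp p b ->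
  ideal_bracket x q \in comp p (a (+) b).
  by move=> xa qb; exact: br_even.
have y0A : y0 \in annihilator_space.
  apply/annihilatorP => q; elim/comp_ind: q => [q r IHq IHr|[] q qb].
  - by rewrite (linearfD (ideal_bracket_linr _)) linearD IHq IHr addr0.
  - by rewrite chi_odd //; exact: br_comp y0g qb.
  - have := yA q; rewrite phiE [X in _ + X]chi_odd ?addr0 //.
    exact: br_comp y1g qb.
exists y0, y1; split=> //.
have -> : y1 = y - y0 by rewrite e addrAC subrr add0r.
by rewrite rpredB //; exact/annihilatorP.
Qed.

Lemma annihilator_br x y : x \in annihilator_space -> y \in annihilator_space ->
  br x y \in annihilator_space.
Proof.
have hom a b : forall u v, u \in comp g a -> v \in comp g b ->
    u \in annihilator_space -> v \in annihilator_space ->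
    br u v \in annihilator_space.
  move=> u v ua vb /annihilatorP uA /annihilatorP vA.
  apply/annihilatorP => q; elim/comp_ind: q => [q r IHq IHr|c q qc].
    by rewrite (linearfD (ideal_bracket_linr _)) linearD IHq IHr addr0.
  have -> : ideal_bracket (br u v) q = ideal_bracket u (ideal_bracket v q)
      - ssign a b *: ideal_bracket v (ideal_bracket u q).
    apply: val_inj; apply/eqP; rewrite eq_sym; apply/eqP.
    transitivity (br u (br v (val q)) - ssign a b *: br v (br u (val q))) => //.
    by rewrite (br_jacobi ua vb qc) addrK.
  by rewrite linearB linearZ /= uA vA scaler0 subr0.
move=> /annihilator_graded [x0 [x1 [x0A x1A x0g x1g ->]]].
move=> /annihilator_graded [y0 [y1 [y0A y1A y0g y1g ->]]].
rewrite (linearfD (br_linl _)) !(linearfD (br_linr _)).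
by rewrite !rpredD //; [exact: hom x0g y0g _ _ | exact: hom x0g y1g _ _
                   | exact: hom x1g y0g _ _ | exact: hom x1g y1g _ _].
Qed.

Definition whittaker_annihilator : gradedSubalgebra g :=
  GradedSubalgebra annihilator_graded annihilator_br.

Lemma ideal_sub_annihilator x : x \in subspace_pred p ->
  x \in subspace_pred whittaker_annihilator.
Proof.
move=> xp; apply/annihilatorP => q.
have -> : ideal_bracket x q = br (Sub x xp : p) q by exact: val_inj.
by rewrite lsaHom_br.
Qed.

Definition annihilator_incl (q : p) : whittaker_annihilator :=
  Sub (val q) (ideal_sub_annihilator (valP q)).
End WhittakerAnnihilator.

Section WordAction.
Variables (K : numFieldType) (X : choiceType) (W : lmodType K).
Variable T : X -> W -> W.
Hypothesis T_lin : forall x, linear (T x).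

Definition word_act (w : {fmonom X}) (m : W) : W := foldr T m w.
Definition free_act (p : {malg K[{fmonom X}]}) (m : W) : W :=
  free_lift (word_act^~ m) p.

Lemma free_act_linl m : linear (free_act^~ m).
Proof. by move=> c p q; rewrite /free_act linearP. Qed.

Lemma word_act_linr w : linear (word_act w).
Proof.
case: w => w c m n; rewrite /word_act /=; elim: w => //= x w ->.
exact: T_lin.
Qed.

Lemma free_act_linr p : linear (free_act p).
Proof.
move=> c m n; move: p; apply: malg_ind => [|a u v IHu IHv|w].
- by rewrite !(linearf0 (free_act_linl _)) scaler0 addr0.
- rewrite !free_act_linl IHu IHv !scalerDr addrACA !scalerA.
  by rewrite (mulrC a c).
- by rewrite /free_act !free_liftU word_act_linr.
Qed.

Lemma free_actU x m : free_act << fmu x >> m = T x m.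
Proof. by rewrite /free_act free_liftU /word_act fmuE. Qed.

Lemma free_act1 m : free_act 1 m = m.
Proof. by rewrite /free_act [free_lift _ _]free_liftU /word_act fm1. Qed.

Lemma free_actM p q m : free_act (p * q) m = free_act p (free_act q m).
Proof.
move: p; apply: malg_ind => [|a u v IHu IHv|w].
- by rewrite mul0r !(linearf0 (free_act_linl _)).
- rewrite malg_mullin [LHS]free_act_linl [RHS]free_act_linl.
  by congr (_ *: _ + _); [exact: IHu | exact: IHv].
move: q; apply: malg_ind => [|a u v IHu IHv|w'].
- rewrite mulr0 !(linearf0 (free_act_linl _)).
  by rewrite (linearf0 (free_act_linr _)).
- rewrite malg_mulrin [LHS]free_act_linl.
  rewrite [free_act (a *: u + v) m]free_act_linl [RHS]free_act_linr.
  by congr (_ *: _ + _); [exact: IHu | exact: IHv].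
by rewrite malgUM /free_act !free_liftU /word_act fmM foldr_cat.
Qed.
End WordAction.

Section FreeAlgebra.
Variables (K : numFieldType) (X : choiceType).

Definition free_alg : Type := {malg K[{fmonom X}]}.
HB.instance Definition _ := GRing.Lalgebra.on free_alg.
HB.instance Definition _ := GRing.Lalgebra_isAlgebra.Build K free_alg
  (@malg_scaleAr K {fmonom X}).

Definition fgen (x : X) : free_alg := << fmu x >>.

Definition free_counit (p : free_alg) : K := mcoeff mone p.
HB.instance Definition _ := GRing.RMorphism.copy free_counit
  (@mcoeff {fmonom X} K mone).

Lemma free_counitZ c p : free_counit (c *: p) = c * free_counit p.
Proof. exact: mcoeffZ. Qed.

Lemma free_counit_gen x : free_counit (fgen x) = 0.
Proof. by rewrite /free_counit /fgen mcoeffU1 fm1_eq1. Qed.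

Lemma free_alg_ind (P : free_alg -> Prop) :
  P 0 -> (forall c p q, P p -> P q -> P (c *: p + q)) -> P 1 ->
  (forall x p, P p -> P (fgen x * p)) -> forall p, P p.
Proof.
move=> P0 PZD P1 PM; apply: malg_ind => // -[w].
elim: w => [|x w IHw]; first by rewrite -fmoneE; exact: P1.
suff -> : << FMonom (x :: w) >> = (fgen x * << FMonom w >> : free_alg).
  exact: PM.
rewrite [RHS]malgUM; suff -> : FMonom (x :: w) = mmul (fmu x) (FMonom w) by [].
by rewrite -[RHS]fmK fmM fmU.
Qed.
End FreeAlgebra.

Section AlgebraQuotient.
Variables (K : fieldType) (A : algType K) (R : A -> Prop).

Definition gen_ideal : subspace A :=
  span (fun s => exists p r q, R r /\ s = p * r * q).

Lemma gen_ideal_rel r : R r -> r \in gen_ideal.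
Proof. by move=> rr; apply: span_gen; exists 1, r, 1; rewrite mul1r mulr1. Qed.

Lemma gen_idealMl p s : s \in gen_ideal -> p * s \in gen_ideal.
Proof.
move: s; apply: span_ind => [|c u v IHu IHv|_ [p' [r [q [rr ->]]]]].
- by rewrite mulr0 rpred0.
- by rewrite mulrDr -scalerAr; exact: subspaceZD.
- by apply: span_gen; exists (p * p'), r, q; rewrite !mulrA.
Qed.

Lemma gen_idealMr p s : s \in gen_ideal -> s * p \in gen_ideal.
Proof.
move: s; apply: span_ind => [|c u v IHu IHv|_ [p' [r [q [rr ->]]]]].
- by rewrite mul0r rpred0.
- by rewrite mulrDl -scalerAl; exact: subspaceZD.
- by apply: span_gen; exists p', r, (q * p); rewrite !mulrA.
Qed.

Hypothesis proper : 1 \notin gen_ideal.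

Definition alg_quot of 1 \notin gen_ideal : Type := lquot gen_ideal.
Local Notation Q := (alg_quot proper).
HB.instance Definition _ := GRing.Lmodule.on Q.

Definition aproj (p : A) : Q := lproj gen_ideal p.
Definition arepr (u : Q) : A := lrepr u.

Lemma areprK : cancel arepr aproj. Proof. exact: lreprK. Qed.
Lemma aproj_is_linear : linear aproj. Proof. exact: lproj_is_linear. Qed.
HB.instance Definition _ := GRing.isLinear.Build K A Q _ aproj aproj_is_linear.

Lemma aprojP p q : aproj p = aproj q <-> p - q \in gen_ideal.
Proof. exact: lprojP. Qed.

Definition alg_quot_mul : Q -> Q -> Q :=
  locked_with opaque_key (fun u v => aproj (arepr u * arepr v)).

Lemma aprojMdef p q : aproj (p * q) = alg_quot_mul (aproj p) (aproj q).
Proof.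
rewrite /alg_quot_mul locked_withE; apply/esym/aprojP.
set p' := arepr _; set q' := arepr _.
have -> : p' * q' - p * q = (p' - p) * q' + p * (q' - q).
  by rewrite mulrBl mulrBr addrA subrK.
by apply: rpredD; [apply: gen_idealMr | apply: gen_idealMl]; exact: lrepr_proj.
Qed.

Lemma alg_quot_mulA : associative alg_quot_mul.
Proof.
move=> u v w; rewrite -[u]areprK -[v]areprK -[w]areprK.
by rewrite -!aprojMdef mulrA.
Qed.
Lemma alg_quot_mul1l : left_id (aproj 1) alg_quot_mul.
Proof. by move=> u; rewrite -[u]areprK -aprojMdef mul1r. Qed.
Lemma alg_quot_mul1r : right_id (aproj 1) alg_quot_mul.
Proof. by move=> u; rewrite -[u]areprK -aprojMdef mulr1. Qed.
Lemma alg_quot_mulDl : left_distributive alg_quot_mul +%R.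
Proof.
move=> u v w; rewrite -[u]areprK -[v]areprK -[w]areprK.
by rewrite -linearD -!aprojMdef mulrDl linearD.
Qed.
Lemma alg_quot_mulDr : right_distributive alg_quot_mul +%R.
Proof.
move=> u v w; rewrite -[u]areprK -[v]areprK -[w]areprK.
by rewrite -linearD -!aprojMdef mulrDr linearD.
Qed.
Lemma alg_quot_1neq0 : aproj 1 != 0.
Proof.
by apply/eqP => /lproj0P; exact/negP.
Qed.
HB.instance Definition _ := GRing.Zmodule_isNzRing.Build Q
  alg_quot_mulA alg_quot_mul1l alg_quot_mul1r alg_quot_mulDl alg_quot_mulDr alg_quot_1neq0.

Lemma alg_quot_scaleAl c (u v : Q) : c *: (u * v) = (c *: u) * v.
Proof.
rewrite -[u]areprK -[v]areprK -linearZ /= -[_ * _]aprojMdef.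
by rewrite -[RHS]aprojMdef -scalerAl linearZ.
Qed.
HB.instance Definition _ := GRing.Lmodule_isLalgebra.Build K Q alg_quot_scaleAl.

Lemma alg_quot_scaleAr c (u v : Q) : c *: (u * v) = u * (c *: v).
Proof.
rewrite -[u]areprK -[v]areprK -linearZ /= -[_ * _]aprojMdef.
by rewrite -[RHS]aprojMdef -scalerAr linearZ.
Qed.
HB.instance Definition _ := GRing.Lalgebra_isAlgebra.Build K Q alg_quot_scaleAr.

Lemma aprojM p q : aproj (p * q) = aproj p * aproj q.
Proof. exact: aprojMdef. Qed.
Lemma aproj1 : aproj 1 = 1. Proof. by []. Qed.
End AlgebraQuotient.

Inductive env_rel (K : numFieldType) (g : lieSuperalgebra K) (A : algType K)
    (f : g -> A) : A -> Prop :=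
| EnvLin c x y : env_rel f (f (c *: x + y) - (c *: f x + f y))
| EnvBr a b x y : x \in comp g a -> y \in comp g b ->
    env_rel f (f x * f y - ssign a b *: (f y * f x) - f (br x y)).

Section RelZero.
Variables (K : numFieldType) (g : lieSuperalgebra K) (A : algType K).
Variable f : g -> A.

Lemma rel_counit (e : {rmorphism A -> K}) :
  (forall c p, e (c *: p) = c * e p) -> (forall x, e (f x) = 0) ->
  1 \notin gen_ideal (env_rel f).
Proof.
move=> eZ ef; apply/negP => /(@span_ind _ _ _ (fun p => e p = 0)) e1.
suff /eqP : e 1 = 0 by rewrite rmorph1 oner_eq0.
apply: e1 => [|c u v eu ev|_ [p [r [q [rr ->]]]]].
- exact: rmorph0.
- by rewrite rmorphD eZ eu ev mulr0 addr0.
suff er : e r = 0 by rewrite !rmorphM er mulr0 mul0r.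
case: rr => [c x y|a b x y _ _].
  by rewrite rmorphB rmorphD eZ !ef mulr0 addr0 subrr.
by rewrite !rmorphB eZ !rmorphM !ef !mulr0 !subr0.
Qed.

Variables (W : lmodType K) (T : g -> W -> W) (F : A -> W -> W).
Hypothesis T_linl : forall m, linear (T^~ m).
Hypothesis T_br : forall a b x y m, x \in comp g a -> y \in comp g b ->
  T (br x y) m = T x (T y m) - ssign a b *: T y (T x m).
Hypothesis F_linl : forall m, linear (F^~ m).
Hypothesis F_linr : forall p, linear (F p).
Hypothesis F_M : forall p q m, F (p * q) m = F p (F q m).
Hypothesis F_T : forall x m, F (f x) m = T x m.

Lemma rel_act_ideal s m : s \in gen_ideal (env_rel f) -> F s m = 0.
Proof.
move: s; apply: span_ind => [|c u v IHu IHv|_ [p [r [q [rr ->]]]]].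
- by rewrite (linearf0 (F_linl _)).
- by rewrite F_linl IHu IHv scaler0 addr0.
rewrite !F_M; set n := F q m.
suff -> : F r n = 0 by exact: linearf0 (F_linr p).
have FD := linearfD (F_linl n).
have FN := linearfN (F_linl n).
have FZ := linearfZ (F_linl n).
case: rr => [c x y|a b x y xa yb].
  by rewrite FD FN FD FZ !F_T T_linl subrr.
by rewrite FD FN FD FN FZ !F_M !F_T (T_br _ xa yb) subrr.
Qed.
End RelZero.

(* U(g): the free associative algebra on the set g modulo the two-sided ideal
   generated by the linearity relations and the supercommutator relations. *)
Section Enveloping.
Variables (K : numFieldType) (g : lieSuperalgebra K).

Lemma env_proper : 1 \notin gen_ideal (env_rel (@fgen K g)).
Proof.
exact: rel_counit (@free_counitZ K g) (@free_counit_gen K g).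
Qed.

Definition env : Type := alg_quot env_proper.
HB.instance Definition _ := GRing.Algebra.on env.

Definition env_proj (p : free_alg K g) : env := aproj env_proper p.
Definition env_repr (u : env) : free_alg K g :=
  @arepr _ _ _ env_proper u.

Lemma env_reprK : cancel env_repr env_proj. Proof. exact: areprK. Qed.
Lemma env_proj_is_linear : linear env_proj. Proof. exact: aproj_is_linear. Qed.
HB.instance Definition _ := GRing.isLinear.Build K (free_alg K g) env _ env_proj
  env_proj_is_linear.
Lemma env_projM p q : env_proj (p * q) = env_proj p * env_proj q.
Proof. exact: aprojM. Qed.
Lemma env_proj_rel p q : env_rel (@fgen K g) (p - q) ->
  env_proj p = env_proj q.
Proof. by move=> r; apply/aprojP/gen_ideal_rel. Qed.

Definition iota : g -> env :=
  locked_with opaque_key (fun x => env_proj (fgen K x)).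
Lemma iotaE x : iota x = env_proj (fgen K x).
Proof. by rewrite /iota locked_withE. Qed.

Lemma iota_is_linear : linear iota.
Proof.
move=> c x y; by rewrite !iotaE -linearP; exact/env_proj_rel/EnvLin.
Qed.
HB.instance Definition _ := GRing.isLinear.Build K g env _ iota iota_is_linear.

Lemma iota_br a b x y : x \in comp g a -> y \in comp g b ->
  iota (br x y) = iota x * iota y - ssign a b *: (iota y * iota x).
Proof.
move=> xa yb; rewrite !iotaE -!env_projM -linearZ -linearB.
by apply/esym/env_proj_rel; exact: EnvBr.
Qed.

Lemma env_ind (P : env -> Prop) :
  (forall c u v, P u -> P v -> P (c *: u + v)) -> P 1 ->
  (forall x u, P u -> P (iota x * u)) -> forall u, P u.
Proof.
move=> PZD P1 PM u; rewrite -[u]env_reprK.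
apply: (free_alg_ind (P := fun p => P (env_proj p))) => //.
- by rewrite linear0 -(addNr 1) -scaleN1r; exact: PZD.
- by move=> c p q Pp Pq; rewrite linearP; exact: PZD.
- by move=> x p Pp; rewrite env_projM -iotaE; exact: PM.
Qed.

Section Action.
Variables (W : lmodType K) (T : g -> W -> W).

Definition env_act : env -> W -> W :=
  locked_with opaque_key (fun u m => free_act T (env_repr u) m).

Hypothesis T_linr : forall x, linear (T x).
Hypothesis T_linl : forall m, linear (T^~ m).
Hypothesis T_br : forall a b x y m, x \in comp g a -> y \in comp g b ->
  T (br x y) m = T x (T y m) - ssign a b *: T y (T x m).

Lemma env_act_proj p m : env_act (env_proj p) m = free_act T p m.
Proof.
rewrite /env_act locked_withE; pose F : free_alg K g -> W -> W := free_act T.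
apply: (lift_lproj (f := linear_pack (free_act_linl T m : linear (F^~ m)))).
move=> v; apply: (@rel_act_ideal _ _ _ _ W T F) => //.
- exact: free_act_linl.
- exact: free_act_linr.
- exact: free_actM.
- exact: free_actU.
Qed.

Lemma env_act_linl m : linear (env_act^~ m).
Proof.
move=> c u v; rewrite -[u]env_reprK -[v]env_reprK -linearP !env_act_proj.
exact: free_act_linl.
Qed.
Lemma env_act_linr u : linear (env_act u).
Proof. by move=> c m n; rewrite /env_act locked_withE; exact: free_act_linr. Qed.
Lemma env_act_iota x m : env_act (iota x) m = T x m.
Proof. by rewrite iotaE env_act_proj free_actU. Qed.
Lemma env_act1 m : env_act 1 m = m.
Proof. by rewrite [LHS]env_act_proj free_act1. Qed.
Lemma env_actM u v m : env_act (u * v) m = env_act u (env_act v m).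
Proof.
rewrite -[u]env_reprK -[v]env_reprK -[_ * _]env_projM !env_act_proj.
exact: free_actM.
Qed.
End Action.

Section Lift.
Variables (A : algType K) (f : g -> A).

Definition env_lift : env -> A := locked_with opaque_key (fun u =>
  free_lift (fun w : {fmonom g} => \prod_(x <- fmonom_val w) f x) (env_repr u)).

Let T (x : g) (a : A) := f x * a.

Lemma env_liftE u : env_lift u = env_act T u 1.
Proof.
rewrite /env_lift /env_act !locked_withE; apply: eq_bigr => w _; congr (_ *: _); rewrite /word_act.
by elim: (fmonom_val w) => [|x s IHs]; rewrite ?big_nil ?big_cons //= IHs.
Qed.

Hypothesis f_lin : linear f.
Hypothesis f_br : forall a b x y, x \in comp g a -> y \in comp g b ->
  f (br x y) = f x * f y - ssign a b *: (f y * f x).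

Let T_linr x : linear (T x).
Proof. by move=> c a b; rewrite /T mulrDr -scalerAr. Qed.
Let T_linl a : linear (T^~ a).
Proof. by move=> c x y; rewrite /T f_lin mulrDl scalerAl. Qed.
Let T_br a b x y m : x \in comp g a -> y \in comp g b ->
  T (br x y) m = T x (T y m) - ssign a b *: T y (T x m).
Proof. by move=> xa yb; rewrite /T (f_br xa yb) mulrBl -scalerAl !mulrA. Qed.

Lemma env_lift_linear : linear env_lift.
Proof. by move=> c u v; rewrite !env_liftE env_act_linl. Qed.
Lemma env_lift1 : env_lift 1 = 1.
Proof. by rewrite env_liftE env_act1. Qed.
Lemma env_lift_iota x : env_lift (iota x) = f x.
Proof. by rewrite env_liftE env_act_iota // /T mulr1. Qed.
Lemma env_liftM u v : env_lift (u * v) = env_lift u * env_lift v.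
Proof.
rewrite !env_liftE env_actM //; move: (env_act T v 1) => a.
elim/env_ind: u => [c u u' IHu IHu'||x u IHu].
- by rewrite !env_act_linl // mulrDl IHu IHu' scalerAl.
- by rewrite !env_act1 // mul1r.
- by rewrite !env_actM // !env_act_iota // IHu /T mulrA.
Qed.
End Lift.
End Enveloping.

(* The tensor product U(g) (x)_{U(h)} M for a subalgebra h of g and an
   h-supermodule M: the free vector space on U(g) x M modulo the linearity
   relations in each argument and the U(h)-balancing relations. *)
Section Induction.
Variables (K : numFieldType) (g : lieSuperalgebra K) (h : gradedSubalgebra g).
Variable M : supermodule h.

(* The algebra morphism U(h) -> U(g) induced by the inclusion of h in g. *)
Definition env_incl : env h -> env g := env_lift (fun y : h => iota (val y)).

Definition tensor_gen (u : env g) (m : M) : {malg K[(env g * M)%type]} :=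
  << (u, m) >>.

Inductive ind_rel : {malg K[(env g * M)%type]} -> Prop :=
| IndLinl c u v m : ind_rel (tensor_gen (c *: u + v) m
    - (c *: tensor_gen u m + tensor_gen v m))
| IndAddr u m n : ind_rel (tensor_gen u (m + n)
    - (tensor_gen u m + tensor_gen u n))
| IndBal u (a : env h) m :
    ind_rel (tensor_gen (u * env_incl a) m - tensor_gen u (env_act (@act K h M) a m)).

Definition ind_sort : Type := lquot (span ind_rel).
HB.instance Definition _ := GRing.Lmodule.on ind_sort.

Definition tensor : env g -> M -> ind_sort :=
  locked_with opaque_key (fun u m => lproj (span ind_rel) (tensor_gen u m)).
Lemma tensorE u m : tensor u m = lproj (span ind_rel) (tensor_gen u m).
Proof. by rewrite /tensor locked_withE. Qed.

Lemma tensor_linl m : linear (tensor^~ m).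
Proof.
move=> c u v; rewrite !tensorE -linearP; apply/lprojP/span_gen.
exact: IndLinl.
Qed.

Lemma tensorDr u m n : tensor u (m + n) = tensor u m + tensor u n.
Proof. by rewrite !tensorE -linearD; apply/lprojP/span_gen/IndAddr. Qed.

Lemma tensor_bal u a m :
  tensor (u * env_incl a) m = tensor u (env_act (@act K h M) a m).
Proof. by rewrite !tensorE; exact/lprojP/span_gen/IndBal. Qed.

Lemma ind_ind (P : ind_sort -> Prop) :
  P 0 -> (forall c s t, P s -> P t -> P (c *: s + t)) ->
  (forall u m, P (tensor u m)) -> forall t, P t.
Proof.
move=> P0 PZD PT t; rewrite -[t]lreprK.
apply: (malg_ind (P := fun p => P (lproj _ p))).
- by rewrite linear0.
- by move=> c u v Pu Pv; rewrite linearP; exact: PZD.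
- by case=> u m; rewrite -[lproj _ _]tensorE; exact: PT.
Qed.

Section Lift.
Variables (W : lmodType K) (F : env g -> M -> W).

Definition ind_lift : ind_sort -> W :=
  locked_with opaque_key (fun t => free_lift (fun k => F k.1 k.2) (lrepr t)).

Hypothesis F_linl : forall m, linear (F^~ m).
Hypothesis F_Dr : forall u m n, F u (m + n) = F u m + F u n.
Hypothesis F_bal : forall u a m,
  F (u * env_incl a) m = F u (env_act (@act K h M) a m).

Lemma ind_lift_proj p : ind_lift (lproj _ p) = free_lift (fun k => F k.1 k.2) p.
Proof.
rewrite /ind_lift locked_withE; pose L := free_lift (fun k => F k.1 k.2).
suff L0 : forall q, q \in span ind_rel -> L q = 0 by exact: (lift_lproj (f := L) L0).
have LT u m : L (tensor_gen u m) = F u m by exact: free_liftU.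
have LB q r : L (q - r) = L q - L r by exact: linearB.
have LP c q r : L (c *: q + r) = c *: L q + L r by exact: linearP.
have LD q r : L (q + r) = L q + L r by exact: linearD.
apply: span_ind => [|c u v Hu Hv|_ []].
- exact: linear0.
- by rewrite [LHS]LP Hu Hv scaler0 addr0.
- move=> c u v m; rewrite [LHS]LB [X in _ - X]LP; apply/eqP; rewrite subr_eq0.
  by apply/eqP; rewrite [LHS]LT [RHS](congr2 _ (congr1 _ (LT u m)) (LT v m)) F_linl.
- move=> u m n; rewrite [LHS]LB [X in _ - X]LD; apply/eqP; rewrite subr_eq0.
  by apply/eqP; rewrite [LHS]LT [RHS](congr2 _ (LT u m) (LT u n)) F_Dr.
- move=> u a m; rewrite [LHS]LB; apply/eqP; rewrite subr_eq0.
  by apply/eqP; rewrite [LHS]LT [RHS]LT F_bal.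
Qed.

Lemma ind_lift_tensor u m : ind_lift (tensor u m) = F u m.
Proof. by rewrite tensorE [LHS]ind_lift_proj /tensor_gen free_liftU. Qed.

Lemma ind_lift_linear : linear ind_lift.
Proof.
by move=> c s t; rewrite -[s]lreprK -[t]lreprK -linearP !ind_lift_proj linearP.
Qed.
End Lift.

Definition ind_act (x : g) (t : ind_sort) : ind_sort :=
  ind_lift (fun u m => tensor (iota x * u) m) t.

Section ActLemmas.
Variable x : g.
Let F u m := tensor (iota x * u) m.
Let F_linl m : linear (F^~ m).
Proof. by move=> c u v; rewrite /F mulrDr -scalerAr tensor_linl. Qed.
Let F_Dr u m n : F u (m + n) = F u m + F u n.
Proof. exact: tensorDr. Qed.
Let F_bal u a m : F (u * env_incl a) m = F u (env_act (@act K h M) a m).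
Proof. by rewrite /F mulrA tensor_bal. Qed.

Lemma ind_act_tensor u m : ind_act x (tensor u m) = tensor (iota x * u) m.
Proof. exact: ind_lift_tensor. Qed.
Lemma ind_act_linr : linear (ind_act x).
Proof. exact: ind_lift_linear. Qed.
End ActLemmas.

Lemma ind_act_linl t : linear (ind_act^~ t).
Proof.
move=> c x y; elim/ind_ind: t => [|d s t IHs IHt|u m].
- by rewrite !(linearf0 (ind_act_linr _)) scaler0 addr0.
- rewrite !ind_act_linr IHs IHt !scalerDr addrACA !scalerA (mulrC d c).
  by [].
- by rewrite !ind_act_tensor linearP mulrDl -scalerAl tensor_linl.
Qed.

Lemma ind_act_br a b x y t : x \in comp g a -> y \in comp g b ->
  ind_act (br x y) t
    = ind_act x (ind_act y t) - ssign a b *: ind_act y (ind_act x t).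
Proof.
move=> xa yb; elim/ind_ind: t => [|d s t IHs IHt|u m].
- by rewrite !(linearf0 (ind_act_linr _)) scaler0 subr0.
- rewrite !ind_act_linr IHs IHt.
  rewrite scalerBr scalerDr opprD !scalerA (mulrC d) -!scalerA.
  by rewrite addrACA.
- rewrite !ind_act_tensor (iota_br xa yb) mulrBl -scalerAl !mulrA.
  rewrite (linearfD (tensor_linl m)) (linearfN (tensor_linl m)).
  by rewrite (linearfZ (tensor_linl m)).
Qed.

Inductive env_monomial : bool -> env g -> Prop :=
| EnvOne : env_monomial false 1
| EnvCons a b x u : x \in comp g a -> env_monomial b u ->
    env_monomial (a (+) b) (iota x * u).

Definition env_comp (a : bool) : subspace (env g) := span (env_monomial a).

Definition ind_comp (a : bool) : subspace ind_sort :=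
  span (fun t => exists b c u m, [/\ u \in env_comp b, m \in comp M c,
                                     a = b (+) c & t = tensor u m]).

Lemma env_comp_iota a b x u : x \in comp g a -> u \in env_comp b ->
  iota x * u \in env_comp (a (+) b).
Proof.
move=> xa; move: u; apply: span_ind => [|c u v IHu IHv|u mu].
- by rewrite mulr0 rpred0.
- by rewrite mulrDr -scalerAr; exact: subspaceZD.
- exact/span_gen/EnvCons.
Qed.

Lemma env_comp_cover u : exists u0 u1,
  [/\ u0 \in env_comp false, u1 \in env_comp true & u = u0 + u1].
Proof.
elim/env_ind: u => [c _ _ [u0 [u1 [u0c u1c ->]]] [v0 [v1 [v0c v1c ->]]]|
                   |x _ [u0 [u1 [u0c u1c ->]]]].
- exists (c *: u0 + v0), (c *: u1 + v1).
  by rewrite !subspaceZD // scalerDr addrACA.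
- exists 1, 0; rewrite rpred0 addr0; split=> //.
  exact/span_gen/EnvOne.
- have [x0 [x1 [x0g x1g ->]]] := comp_cover x.
  exists (iota x0 * u0 + iota x1 * u1), (iota x0 * u1 + iota x1 * u0).
  split.
  + apply: rpredD; first exact: (env_comp_iota x0g u0c).
    exact: (env_comp_iota x1g u1c).
  + apply: rpredD; first exact: (env_comp_iota x0g u1c).
    exact: (env_comp_iota x1g u0c).
  + rewrite (linearD (@iota K g) x0 x1) mulrDl (mulrDr (iota x0)) (mulrDr (iota x1)).
    exact: addr_shuffle.
Qed.

Lemma ind_cover t : exists t0 t1,
  [/\ t0 \in ind_comp false, t1 \in ind_comp true & t = t0 + t1].
Proof.
elim/ind_ind: t => [|c _ _ [s0 [s1 [s0c s1c ->]]] [t0 [t1 [t0c t1c ->]]]|u m].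
- by exists 0, 0; rewrite !rpred0 addr0.
- exists (c *: s0 + t0), (c *: s1 + t1).
  by rewrite !subspaceZD // scalerDr addrACA.
have [u0 [u1 [u0c u1c ->]]] := env_comp_cover u.
have [m0 [m1 [m0c m1c ->]]] := comp_cover m.
exists (tensor u0 m0 + tensor u1 m1), (tensor u0 m1 + tensor u1 m0); split.
- apply: rpredD; apply: span_gen; first by exists false, false, u0, m0.
  by exists true, true, u1, m1.
- apply: rpredD; apply: span_gen; first by exists false, true, u0, m1.
  by exists true, false, u1, m0.
- rewrite (linearfD (tensor_linl _)) !tensorDr; exact: addr_shuffle.
Qed.

(* The parity involution of U(g), and of the induced module. *)
Definition env_pinv : env g -> env g := env_lift (fun x : g => iota (pinv x)).
End Induction.

Section EnvParity.
Variables (K : numFieldType) (g : lieSuperalgebra K).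
Let f (x : g) := iota (pinv x).
Lemma iota_pinv_linear : linear f.
Proof. by move=> c x y; rewrite /f !linearP. Qed.
Lemma iota_pinv_br a b x y : x \in comp g a -> y \in comp g b ->
  f (br x y) = f x * f y - ssign a b *: (f y * f x).
Proof.
move=> xa yb; rewrite /f (pinv_bilin (@br_linl K g) (@br_linr K g) (@br_even K g)).
by apply: iota_br; rewrite ?(pinv_comp xa) ?(pinv_comp yb) rpredZ.
Qed.
Lemma env_pinv_linear : linear (@env_pinv K g).
Proof. exact: env_lift_linear iota_pinv_linear iota_pinv_br. Qed.
Lemma env_pinv1 : @env_pinv K g 1 = 1.
Proof. exact: env_lift1 iota_pinv_linear iota_pinv_br. Qed.
Lemma env_pinvM u v : @env_pinv K g (u * v) = env_pinv u * env_pinv v.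
Proof. exact: env_liftM iota_pinv_linear iota_pinv_br _ _. Qed.
Lemma env_pinv_iota x : @env_pinv K g (iota x) = iota (pinv x).
Proof. exact: env_lift_iota iota_pinv_linear iota_pinv_br _. Qed.

Lemma env_pinv_comp a u : u \in env_comp g a -> env_pinv u = (-1) ^+ a *: u.
Proof.
move: u; apply: span_ind => [|c u v IHu IHv|u].
- by rewrite (linearf0 env_pinv_linear) scaler0.
- by rewrite env_pinv_linear IHu IHv scalerDr !scalerA mulrC.
elim=> [|{}a b x {}u xa _ IHu]; first by rewrite env_pinv1 scale1r.
rewrite env_pinvM env_pinv_iota (pinv_comp xa) IHu (linearfZ (@iota_is_linear K g)) /=.
by rewrite -scalerAl -scalerAr scalerA -signr_addb.
Qed.
End EnvParity.

Section InclParity.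
Variables (K : numFieldType) (g : lieSuperalgebra K) (h : gradedSubalgebra g).
Variable M : supermodule h.

Lemma pinv_val (y : h) : pinv (val y) = val (pinv y).
Proof.
have [y0 [y1 [y0h y1h ->]]] := comp_cover y.
rewrite (pinvE y0h y1h); exact: (@pinvE K g (val y0) (val y1)).
Qed.

Let f (y : h) := iota (val y).
Lemma iota_val_linear : linear f.
Proof. by move=> c x y; rewrite -[RHS](linearP (@iota K g)). Qed.
Lemma iota_val_br a b x y : x \in comp h a -> y \in comp h b ->
  f (br x y) = f x * f y - ssign a b *: (f y * f x).
Proof. by move=> xa yb; exact: iota_br. Qed.
Lemma env_incl_linear : linear (@env_incl K g h).
Proof. exact: env_lift_linear iota_val_linear iota_val_br. Qed.
Lemma env_incl1 : @env_incl K g h 1 = 1.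
Proof. exact: env_lift1 iota_val_linear iota_val_br. Qed.
Lemma env_inclM u v : @env_incl K g h (u * v) = env_incl u * env_incl v.
Proof. exact: env_liftM iota_val_linear iota_val_br _ _. Qed.
Lemma env_incl_iota x : @env_incl K g h (iota x) = iota (val x).
Proof. exact: env_lift_iota iota_val_linear iota_val_br _. Qed.

Lemma env_pinv_incl (a : env h) :
  env_pinv (env_incl a) = env_incl (env_pinv a).
Proof.
elim/env_ind: a => [c u v IHu IHv||x u IHu].
- rewrite (env_incl_linear c u v) [LHS]env_pinv_linear IHu IHv.
  by rewrite (env_pinv_linear c u v) [RHS]env_incl_linear.
- by rewrite env_incl1 !env_pinv1 env_incl1.
- rewrite (env_inclM (iota x) u) [LHS]env_pinvM IHu (env_pinvM (iota x) u).
  rewrite [RHS]env_inclM; congr (_ * _).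
  by rewrite env_incl_iota !env_pinv_iota env_incl_iota pinv_val.
Qed.

Let T := @act K h M.
Let eact_linl := env_act_linl (@act_linr K h M) (@act_linl K h M) (@act_br K h M).
Let eact1 := env_act1 (@act_linr K h M) (@act_linl K h M) (@act_br K h M).
Let eactM := env_actM (@act_linr K h M) (@act_linl K h M) (@act_br K h M).
Let eact_iota := env_act_iota (@act_linr K h M) (@act_linl K h M) (@act_br K h M).

Lemma pinv_env_act (a : env h) (m : M) :
  pinv (env_act T a m) = env_act T (env_pinv a) (pinv m).
Proof.
elim/env_ind: a m => [c u v IHu IHv||x u IHu] m.
- by rewrite eact_linl pinv_is_linear IHu IHv env_pinv_linear eact_linl.
- by rewrite env_pinv1 !eact1.
- rewrite env_pinvM env_pinv_iota !eactM !eact_iota -IHu.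
  exact: pinv_bilin (@act_linl K h M) (@act_linr K h M) (@act_even K h M) _ _.
Qed.

Let F (u : env g) (m : M) : ind_sort M := tensor (env_pinv u) (pinv m).

Let F_linl m : linear (F^~ m).
Proof. by move=> c u v; rewrite /F env_pinv_linear tensor_linl. Qed.
Let F_Dr u m n : F u (m + n) = F u m + F u n.
Proof. by rewrite /F linearD tensorDr. Qed.
Let F_bal u a m : F (u * env_incl a) m = F u (env_act T a m).
Proof. by rewrite /F env_pinvM env_pinv_incl tensor_bal pinv_env_act. Qed.

Let ind_pinv : ind_sort M -> ind_sort M := ind_lift F.

Lemma tensorZr (u : env g) c (m : M) : tensor u (c *: m) = c *: tensor u m.
Proof.
have -> : c *: m = env_act T (c *: 1) m.
  by rewrite (linearfZ (eact_linl m)) eact1.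
rewrite -tensor_bal (linearfZ env_incl_linear) env_incl1 -scalerAr mulr1.
exact: linearfZ (tensor_linl m) c u.
Qed.

Lemma ind_pinv_comp a t : t \in ind_comp M a -> ind_pinv t = (-1) ^+ a *: t.
Proof.
have lin := ind_lift_linear F_linl F_Dr F_bal.
move: t; apply: span_ind => [|c s t IHs IHt|_ [b [c [u [m [ub mc -> ->]]]]]].
- by rewrite [LHS](linearf0 lin) scaler0.
- by rewrite [LHS]lin -/ind_pinv IHs IHt scalerDr !scalerA mulrC.
rewrite [LHS](ind_lift_tensor F_linl F_Dr F_bal) /F.
rewrite (env_pinv_comp ub) (pinv_comp mc) tensorZr.
by rewrite (linearfZ (tensor_linl m)) scalerA mulrC -signr_addb.
Qed.

Lemma ind_direct t : t \in ind_comp M false -> t \in ind_comp M true -> t = 0.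
Proof.
move=> /ind_pinv_comp e0 /ind_pinv_comp; rewrite e0 scale1r scaleN1r => /eqP.
rewrite -addr_eq0 -mulr2n -scaler_nat scaler_eq0 pnatr_eq0 /=.
by move/eqP.
Qed.

Definition ind_superspace : superspace K :=
  Superspace (@ind_cover K g h M) ind_direct.

Lemma ind_act_even a b x t : x \in comp g a -> t \in comp ind_superspace b ->
  ind_act x t \in comp ind_superspace (a (+) b).
Proof.
move=> xa; move: t; apply: span_ind => [|c s t IHs IHt|_ [c [d [u [m [uc md -> ->]]]]]].
- by rewrite (linearf0 (ind_act_linr _)) rpred0.
- by rewrite ind_act_linr; exact: subspaceZD.
rewrite ind_act_tensor; apply: span_gen.
by exists (a (+) c), d, (iota x * u), m; rewrite env_comp_iota // addbA.
Qed.

Definition Ind : supermodule g :=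
  @Supermodule K g ind_superspace (@ind_act K g h M) (@ind_act_linl K g h M)
    (@ind_act_linr K g h M) ind_act_even (@ind_act_br K g h M).
End InclParity.

Section SupermoduleTheory.
Variables (K : numFieldType) (g : lieSuperalgebra K).

Definition subsupermodule (V : supermodule g) (N : subspace V) :=
  graded N /\ forall (x : g) (v : V), v \in N -> act x v \in N.

Definition irreducible (V : supermodule g) :=
  (exists v : V, v != 0) /\
  forall N : subspace V, subsupermodule N ->
    (forall v, v \in N -> v = 0) \/ (forall v, v \in N).

Definition generated_by (V : supermodule g) (w : V) :=
  forall N : subspace V, subsupermodule N -> w \in N -> forall v, v \in N.

Definition smod_iso (V W : supermodule g) :=
  exists f : {linear V -> W},
    [/\ bijective f,
        forall a v, v \in comp V a -> f v \in comp W a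
      & forall (x : g) (v : V), f (act x v) = act x (f v)].

(* The action on the shifted module carries no sign: the variant twisted by
   (-1)^|x| is isomorphic to it through v |-> (-1)^|v| v. *)
Section ParityShift.
Variable V : supermodule g.

Lemma parity_cover (v : V) : exists v0 v1,
  [/\ v0 \in comp V (~~ false), v1 \in comp V (~~ true) & v = v0 + v1].
Proof.
by have [v0 [v1 [? ? ->]]] := comp_cover v; exists v1, v0; rewrite addrC.
Qed.

Lemma parity_direct (v : V) :
  v \in comp V (~~ false) -> v \in comp V (~~ true) -> v = 0.
Proof. by move=> v1 v0; exact: comp_direct v0 v1. Qed.

Definition parity_superspace : superspace K :=
  @Superspace K V (fun a => comp V (~~ a)) parity_cover parity_direct.

Lemma parity_act_even a b x (v : V) : x \in comp g a -> v \in comp V (~~ b) ->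
  act x v \in comp V (~~ (a (+) b)).
Proof. by move=> xa vb; rewrite -addbN; exact: act_even. Qed.

Definition parity_shift : supermodule g :=
  @Supermodule K g parity_superspace (@act K g V) (@act_linl K g V)
    (@act_linr K g V) parity_act_even (@act_br K g V).
End ParityShift.

Definition iso_upto_parity (V W : supermodule g) :=
  smod_iso V W \/ smod_iso V (parity_shift W).
End SupermoduleTheory.

Section QuasiWhittaker.
Variables (K : numFieldType) (g : lieSuperalgebra K) (p : gradedIdeal g).
Variable phi : lsaHom p (scalar_lsa K).

(* Membership in V_phi. *)
Definition whittaker_vector (V : supermodule g) (v : V) :=
  forall q : p, act (val q) v = (phi q : K) *: v.

Definition quasi_whittaker (V : supermodule g) :=
  exists a (w : V),
    [/\ w \in comp V a, whittaker_vector w & generated_by w].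

(* The last clause is dim V_phi = 1. *)
Definition bland (V : supermodule g) :=
  [/\ quasi_whittaker V, irreducible V
    & exists v : V, [/\ v != 0, whittaker_vector v
        & forall w : V, whittaker_vector w -> exists c : K, w = c *: v]].

Definition extends
    (phi' : lsaHom (whittaker_annihilator phi) (scalar_lsa K)) :=
  forall q : p, phi' (annihilator_incl phi q) = phi q.

Definition extendable := exists phi', extends phi'.

Record extension := Extension {
  extension_hom :> lsaHom (whittaker_annihilator phi) (scalar_lsa K);
  extension_extends : extends extension_hom
}.

Definition Vind (phi' : extension) : supermodule g := Ind (one_dim phi').
End QuasiWhittaker.

(* Main.v *)
(** Write h for the Whittaker annihilator of phi.  Let V be generated by v, a
    quasi-Whittaker vector that spans an h-stable line, and filter V by the
    length of words x_1 .. x_k v.  For q in p the operator q - phi(q) lowers the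
    filtration by one, and its leading term is the contraction
    x |-> phi([q, x]), which separates the points of g / h.  An Euler operator
    built from finitely many such contractions multiplies words of length k by
    k modulo shorter words.  In characteristic 0 it follows that the
    quasi-Whittaker vectors are the multiples of v and that every nonzero
    submodule contains v.

    That v is nonzero in V(phi') is the Poincare-Birkhoff-Witt part.  Take a
    totally ordered homogeneous basis of g whose letters in h come last, and
    define a functional on words by rewriting their descents
    x y = (-1)^(|x||y|) y x + [x, y]; its consistency is a diamond lemma, and it
    satisfies value (u y) = phi'(y) value (u) for y in h, and value 1 = 1.

    Conversely, on a bland module V the line of quasi-Whittaker vectors is
    h-stable, hence defines an extension phi', and the map from V(phi') to V is
    injective because its kernel does not contain v. *)
From HB Require Import structures.
From mathcomp Require Import all_boot all_order all_algebra.
From mathcomp Require Import boolp finmap monalg wochoice zify ring.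
From mathcomp Require Import reals complex.
Require Import Defs.

Set Implicit Arguments.
Unset Strict Implicit.
Unset Printing Implicit Defensive.

Import GRing.Theory Num.Theory.

(** * Words and inversions *)

Section Words.
Variables (I : eqType) (lt : rel I) (d : pred I).

(** An equal pair of odd letters also counts, because 2xx = [x, x] rewrites it into shorter
    words. *)
Definition descent (i j : I) := lt j i || (i == j) && d i.

Lemma lt_descent i j : lt j i -> descent i j.
Proof. by rewrite /descent => ->. Qed.

Fixpoint first_descent (s : seq I) : option (seq I * I * I * seq I) :=
  if s is i :: t then
    if t is j :: b then
      if descent i j then Some ([::], i, j, b) else
      if first_descent t is Some (a, k, l, c) then Some (i :: a, k, l, c)
      else None
    else None
  else None.

Lemma first_descent_cons2 i j b : first_descent [:: i, j & b] =
  if descent i j then Some ([::], i, j, b) else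
  if first_descent (j :: b) is Some (a, k, l, c) then Some (i :: a, k, l, c)
  else None.
Proof. by []. Qed.

Lemma first_descentP s a i j b : first_descent s = Some (a, i, j, b) ->
  s = a ++ i :: j :: b /\ descent i j.
Proof.
elim: s a i j b => // x [//|y s] IHs a i j b; rewrite first_descent_cons2.
case: ifP => [xy [<- <- <- <-]//|_].
case E: (first_descent _) => [[[[a' i'] j'] b']|//] [<- <- <- <-].
by have [/= -> ?] := IHs _ _ _ _ E.
Qed.

Lemma first_descent_None s :
  first_descent s = None -> sorted (fun i j => ~~ descent i j) s.
Proof.
elim: s => // x [//|y s] IHs; rewrite first_descent_cons2; case: ifP => // xy.
case: (first_descent (y :: s)) IHs => [[[[? ?] ?] ?]|] // IHs _.
by rewrite [sorted _ _]/= xy; exact: IHs.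
Qed.

Lemma first_descent_min s a i j b a' k l b' :
  first_descent s = Some (a, i, j, b) -> s = a' ++ k :: l :: b' ->
  descent k l -> size a <= size a'.
Proof.
elim: s a i j b a' => // x [//|y s] IHs a i j b [|x' a']; rewrite first_descent_cons2.
  by move=> + [<- <- _] => /[swap] ->; case=> <-.
case: ifP => [_ [<-]//|_].
case E: (first_descent _) => [[[[a1 i1] j1] b1]|//] [<- _ _ _] [_ e] kl.
exact: IHs E e kl.
Qed.

(** Sorts the pairs of descents for the diamond lemma: those sharing a letter lead to the hexagon
    identity, the disjoint ones to the square. *)
Lemma word_overlap (a a' b b' : seq I) i j k l :
  a ++ i :: j :: b = a' ++ k :: l :: b' -> size a < size a' ->
  [/\ a' = rcons a i, k = j & b = l :: b'] \/
  exists c, a' = a ++ i :: j :: c /\ b = c ++ k :: l :: b'.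
Proof.
elim: a a' => [|x a IHa] [|x' a'] //= [<-].
  case: a' => [[<- ->]|y a' [<- ->]] _; first by left.
  by right; exists a'.
rewrite ltnS => e lt_s; case: (IHa _ e lt_s) => [[-> -> ->]|[c [-> ->]]]; first by left.
by right; exists c.
Qed.

Fixpoint inversions (s : seq I) : nat :=
  if s is i :: t then (count (lt^~ i) t + inversions t)%N else 0%N.

Hypothesis lt_asym : forall i j, lt i j -> ~~ lt j i.

Lemma descent_eq i : descent i i = d i.
Proof.
by rewrite /descent eqxx; case E: (lt i i) => //; have := lt_asym E; rewrite E.
Qed.

Lemma inversions_swap a i j b : lt j i ->
  inversions (a ++ i :: j :: b) = (inversions (a ++ j :: i :: b)).+1.
Proof.
move=> ji; elim: a => [|x a IHa] /=; last by rewrite IHa !count_cat /=; lia.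
by rewrite ji (negPf (lt_asym ji)); lia.
Qed.

Lemma inversions_le s : inversions s <= size s * size s.
Proof.
by elim: s => //= x s IHs; have := count_size (lt^~ x) s; nia.
Qed.

(** Decreases along every rewriting: a swap removes an inversion and a bracket shortens the word.
    The cube outweighs the inversions, whose number is at most quadratic in the length. *)
Definition weight (s : seq I) := (size s * size s * size s + inversions s)%N.

Lemma weight_swap a i j b : lt j i ->
  weight (a ++ j :: i :: b) < weight (a ++ i :: j :: b).
Proof.
by move=> ji; rewrite /weight (inversions_swap _ _ ji) !size_cat /=; lia.
Qed.

Lemma weight_size s t : size s < size t -> weight s < weight t.
Proof.
rewrite /weight => st; have := inversions_le s.
have := leq_mul (leq_mul st st) st.
move: (size s) (size t) (inversions s) (inversions t) {st} => m n x y; lia.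
Qed.
End Words.

Local Open Scope ring_scope.

(** * The rewriting functional *)

Section PBW.
Variables (K : numFieldType) (g : lieSuperalgebra K) (I : choiceType).
Variables (lt : rel I) (e : I -> g) (d : pred I) (co : {linear g -> {malg K[I]}}).
Hypothesis lt_asym : forall i j, lt i j -> ~~ lt j i.
Hypothesis lt_trans : transitive lt.
Hypothesis lt_total : forall i j, i != j -> lt i j || lt j i.
Hypothesis e_comp : forall i, e i \in comp g (d i).
Hypothesis e_span : forall a x, x \in comp g a ->
  x \in span (fun y => exists2 i, d i = a & y = e i).
Hypothesis co_e : forall i, co (e i) = << i >>.

Variables (H : pred I) (chi : I -> K).
Hypothesis H_upper : forall i j, H i -> lt i j -> H j.
Hypothesis H_br : forall i j, H i -> H j ->
  br (e i) (e j) \in span (fun y => exists2 k, H k & y = e k).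
Hypothesis chi_br : forall i j, H i -> H j ->
  free_lift (chi : I -> K^o) (co (br (e i) (e j))) = 0.
Hypothesis chi_odd_eq0 : forall i, d i -> chi i = 0.

Local Notation descent := (descent lt d).
Local Notation first_descent := (first_descent lt d).
Local Notation weight := (weight lt).
Local Notation sg i j := (ssign (d i) (d j) : K).

(** The value on ordered monomials: a letter outside the subalgebra kills the word, the others act
    by the character. *)
Definition base_value (s : seq I) : K :=
  if all H s then \prod_(i <- s) chi i else 0.

(* The first argument is fuel; [weight s] is enough for the word s. *)
Fixpoint word_value_rec (n : nat) (s : seq I) : K :=
  if n is n.+1 then
    if first_descent s is Some (a, i, j, b) then
      let t : K := free_lift (fun k => word_value_rec n (a ++ k :: b) : K^o)
                     (co (br (e i) (e j))) in
      if i == j then t / 2 else sg i j * word_value_rec n (a ++ j :: i :: b) + t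
    else base_value s
  else base_value s.

Lemma eq_free_lift (W : lmodType K) (F G : I -> W) q :
  F =1 G -> free_lift F q = free_lift G q.
Proof. by move=> FG; apply: eq_bigr => k _; rewrite FG. Qed.

(** Every recursive call is on a word of smaller weight, so extra fuel never changes the result. *)
Lemma word_value_fuel m n s : (weight s <= m)%N -> (weight s <= n)%N ->
  word_value_rec m s = word_value_rec n s.
Proof.
elim: m n s => [|m IHm] n s.
  case: s => [_|x s]; first by case: n.
  by rewrite /weight leqn0 /= mulSn.
case: n => [_|n sm sn].
  case: s => [//|x s].
  by rewrite /weight leqn0 /= mulSn.
rewrite /=; case E: first_descent => [[[[a i] j] b]|//].
have [es ij] := first_descentP E.
have smaller k : (weight (a ++ k :: b) < weight s)%N.
  by apply: weight_size => //; rewrite es !size_cat /= ltn_add2l.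
have -> : free_lift (fun k => word_value_rec m (a ++ k :: b) : K^o)
            (co (br (e i) (e j)))
        = free_lift (fun k => word_value_rec n (a ++ k :: b) : K^o)
            (co (br (e i) (e j))).
  apply: eq_free_lift => k; apply: IHm.
    by rewrite -ltnS; exact: leq_trans sm.
  by rewrite -ltnS; exact: leq_trans sn.
case: eqVneq => // nij; congr (_ * _ + _); apply: IHm; rewrite -ltnS.
  apply: leq_trans sm; rewrite es; apply: weight_swap => //.
  by case/orP: ij => // /andP[/eqP e' _]; rewrite e' eqxx in nij.
apply: leq_trans sn; rewrite es; apply: weight_swap => //.
by case/orP: ij => // /andP[/eqP e' _]; rewrite e' eqxx in nij.
Qed.

Definition word_value (s : seq I) : K := word_value_rec (weight s) s.

(** * Consistency of the functional: the diamond lemma *)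

Variables (A : algType K) (word : seq I -> A) (value : {linear A -> K^o}).
Hypothesis word_nil : word [::] = 1.
Hypothesis word_cat : forall s t, word (s ++ t) = word s * word t.
Hypothesis value_word : forall s, value (word s) = word_value s.

Definition gen (i : I) : A := word [:: i].

Lemma word_cons i s : word (i :: s) = gen i * word s.
Proof. by rewrite -cat1s word_cat. Qed.

Definition hat (x : g) : A := free_lift gen (co x).
Lemma hat_linear : linear hat.
Proof. by move=> c x y; rewrite /hat !linearP. Qed.
HB.instance Definition _ := GRing.isLinear.Build K g A _ hat hat_linear.

Lemma hat_e i : hat (e i) = gen i.
Proof. by rewrite /hat co_e free_liftU. Qed.

Lemma value_hat a b x : value (word a * hat x * word b) =
  free_lift (fun k => word_value (a ++ k :: b) : K^o) (co x).
Proof.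
rewrite /hat; move: (co x); apply: malg_ind => [|c u v IHu IHv|k].
- by rewrite !linear0 mulr0 mul0r linear0.
- rewrite [in LHS]free_lift_is_linear mulrDr mulrDl -scalerAr -scalerAl linearP.
  by rewrite [RHS]free_lift_is_linear -IHu -IHv.
- by rewrite !free_liftU -value_word word_cat word_cons mulrA.
Qed.

Definition super_rel a b (x y : g) : A :=
  hat x * hat y - ssign a b *: (hat y * hat x) - hat (br x y).

(** Measures how far the functional is from respecting one rewriting inside a word. *)
Definition defect (a : seq I) i j (b : seq I) : K :=
  value (word a * super_rel (d i) (d j) (e i) (e j) * word b).

Lemma super_rel_e i j : super_rel (d i) (d j) (e i) (e j) =
  gen i * gen j - sg i j *: (gen j * gen i) - hat (br (e i) (e j)).
Proof. by rewrite /super_rel !hat_e. Qed.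

Lemma defectE a i j b : defect a i j b = word_value (a ++ i :: j :: b)
  - sg i j * word_value (a ++ j :: i :: b)
  - value (word a * hat (br (e i) (e j)) * word b).
Proof.
rewrite /defect /super_rel !mulrBr !mulrBl !linearB /=; congr (_ - _ - _).
  by rewrite !hat_e -value_word word_cat !word_cons !mulrA.
rewrite !hat_e -scalerAr -scalerAl linearZ /=; congr (_ * _).
by rewrite -value_word word_cat !word_cons !mulrA.
Qed.

Lemma word_valueE s a i j b : first_descent s = Some (a, i, j, b) ->
  let t : K := value (word a * hat (br (e i) (e j)) * word b) in
  word_value s = if i == j then t / 2
                 else sg i j * word_value (a ++ j :: i :: b) + t.
Proof.
move=> E t; have [es ij] := first_descentP E.
have smaller k : (weight (a ++ k :: b) < weight s)%N.
  by apply: weight_size => //; rewrite es !size_cat /= ltn_add2l.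
rewrite {1}/word_value; case Es: (weight s) smaller => [|n] smaller.
  by have := smaller i.
rewrite /= E.
have -> : free_lift (fun k => word_value_rec n (a ++ k :: b) : K^o)
            (co (br (e i) (e j))) = t.
  rewrite /t value_hat; apply: eq_free_lift => k.
  by apply: word_value_fuel => //; exact: smaller.
case: eqVneq => // nij; congr (_ * _ + _); apply: word_value_fuel => //.
rewrite -ltnS -Es es; apply: weight_swap => //.
by case/orP: ij => // /andP[/eqP e' _]; rewrite e' eqxx in nij.
Qed.

(** True by construction, since the functional rewrites the first descent. For an equal odd pair the
    sign is -1, and two halves of the bracket term add up. *)
Lemma defect_first s a i j b :
  first_descent s = Some (a, i, j, b) -> defect a i j b = 0.
Proof.
move=> E; have [es ij] := first_descentP E; have := word_valueE E; rewrite defectE.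
case: eqVneq ij es => [->|_ _ <- ->]; last by rewrite [X in X - _ - _]addrC addrK subrr.
rewrite (descent_eq _ lt_asym) => dj <- ->.
by rewrite /ssign dj /= expr1 mulN1r opprK -splitr subrr.
Qed.

Definition words_upto (n : nat) : subspace A :=
  span (fun u => exists2 s, (size s <= n)%N & u = word s).

Lemma words_upto_mul m n u v :
  u \in words_upto m -> v \in words_upto n -> u * v \in words_upto (m + n).
Proof.
move=> um; move: v; apply: span_ind => [|c v w IHv IHw|_ [t tn ->]].
- by rewrite mulr0 rpred0.
- by rewrite mulrDr -scalerAr; exact: subspaceZD.
move: u um; apply: span_ind => [|c v w IHv IHw|_ [s sm ->]].
- by rewrite mul0r rpred0.
- by rewrite mulrDl -scalerAl; exact: subspaceZD.
apply: span_gen; exists (s ++ t); last by rewrite word_cat.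
by rewrite size_cat leq_add.
Qed.

Lemma words_upto_word s : word s \in words_upto (size s).
Proof. by apply: span_gen; exists s. Qed.

Lemma words_upto_gen i : gen i \in words_upto 1.
Proof. exact: words_upto_word. Qed.

Lemma words_upto_hat x : hat x \in words_upto 1.
Proof.
rewrite /hat; move: (co x); apply: malg_ind => [|c u v IHu IHv|k].
- by rewrite linear0 rpred0.
- by rewrite free_lift_is_linear; exact: subspaceZD.
- by rewrite free_liftU; exact: words_upto_gen.
Qed.

(** The bound is on the length of the whole word, including the two letters of the relation. *)
Definition defect_free (n : nat) := forall a i j b,
  (size a + size b + 2 <= n)%N -> defect a i j b = 0.

Lemma super_rel_linl a b y : linear ((super_rel a b)^~ y).
Proof.
move=> c x x'; rewrite /super_rel hat_linear (br_linl y) hat_linear mulrDl mulrDr.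
rewrite -scalerAl -scalerAr !scalerDr !scalerN !scalerA (mulrC c) !opprD.
by rewrite [LHS](AC (2*2*2) (1*3*5*(2*4*6))).
Qed.

Lemma super_rel_linr a b x : linear (super_rel a b x).
Proof.
move=> c y y'; rewrite /super_rel hat_linear (br_linr x) hat_linear mulrDl mulrDr.
rewrite -scalerAl -scalerAr !scalerDr !scalerN !scalerA (mulrC c) !opprD.
by rewrite [LHS](AC (2*2*2) (1*3*5*(2*4*6))).
Qed.

(** Multilinearity passes from basis words to homogeneous elements; this is needed because a bracket
    of letters is only a combination of letters. *)
Lemma defect_free_rel n a b x y l m u v : defect_free n ->
  x \in comp g a -> y \in comp g b -> (l + m + 2 <= n)%N ->
  u \in words_upto l -> v \in words_upto m ->
  value (u * super_rel a b x y * v) = 0.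
Proof.
move=> dn /e_span xa /e_span yb lmn ul vm; move: x xa.
apply: span_ind => [|c x x' IHx IHx'|_ [i <- ->]].
- by rewrite (linearf0 (super_rel_linl _ _ _)) mulr0 mul0r linear0.
- rewrite super_rel_linl mulrDr mulrDl -scalerAr -scalerAl linearP IHx IHx'.
  by rewrite scaler0 addr0.
move: y yb; apply: span_ind => [|c x x' IHx IHx'|_ [j <- ->]].
- by rewrite (linearf0 (super_rel_linr _ _ _)) mulr0 mul0r linear0.
- rewrite super_rel_linr mulrDr mulrDl -scalerAr -scalerAl linearP IHx IHx'.
  by rewrite scaler0 addr0.
move: u ul; apply: span_ind => [|c x x' IHx IHx'|_ [s sl ->]].
- by rewrite !mul0r linear0.
- by rewrite !mulrDl -!scalerAl linearP IHx IHx' scaler0 addr0.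
move: v vm; apply: span_ind => [|c x x' IHx IHx'|_ [t tm ->]].
- by rewrite mulr0 linear0.
- by rewrite mulrDr -scalerAr linearP IHx IHx' scaler0 addr0.
by apply: dn; apply: leq_trans lmn; rewrite leq_add2r leq_add.
Qed.

(** Expand a word containing both relations, at one place or at the other. The bracket terms leave a
    relation inside a shorter word, so they vanish by hypothesis. *)
Lemma defect_square n a i j c k l b : defect_free n ->
  (size a + size c + size b + 3 <= n)%N ->
  defect a i j (c ++ k :: l :: b)
    + sg i j * defect (a ++ j :: i :: c) k l b
  = defect (a ++ i :: j :: c) k l b
    + sg k l * defect a i j (c ++ l :: k :: b).
Proof.
move=> dn sz.
have e1 : value (word a * hat (br (e i) (e j)) * word c
    * super_rel (d k) (d l) (e k) (e l) * word b) = 0.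
  apply: (defect_free_rel (l := size a + 1 + size c) (m := size b) dn) => //.
  - by apply: leq_trans sz; lia.
  - by rewrite !words_upto_mul ?words_upto_word ?words_upto_hat.
  - exact: words_upto_word.
have e2 : value (word a * super_rel (d i) (d j) (e i) (e j)
    * (word c * hat (br (e k) (e l)) * word b)) = 0.
  apply: (defect_free_rel (l := size a) (m := size c + 1 + size b) dn) => //.
  - by apply: leq_trans sz; lia.
  - exact: words_upto_word.
  - by rewrite !words_upto_mul ?words_upto_word ?words_upto_hat.
have r1E := super_rel_e i j; have r2E := super_rel_e k l.
rewrite /defect !word_cat !word_cons.
set r1 := super_rel _ _ (e i) (e j) in e2 r1E *.
set r2 := super_rel _ _ (e k) (e l) in e1 r2E *; clearbody r1 r2.
pose M := value (word a * r1 * (word c * r2 * word b)).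
have M1 : M = value (word a * r1 * (word c * (gen k * (gen l * word b))))
    - sg k l * value (word a * r1 * (word c * (gen l * (gen k * word b)))).
  rewrite /M r2E !(mulrBr, mulrBl) !linearB /= e2 subr0; congr (_ - _).
    by rewrite !mulrA.
  by rewrite -!(scalerAl, scalerAr) linearZ /= !mulrA.
have M2 : M = value (word a * (gen i * (gen j * word c)) * r2 * word b)
    - sg i j * value (word a * (gen j * (gen i * word c)) * r2 * word b).
  rewrite /M r1E !(mulrBr, mulrBl) !linearB /= !mulrA e1 subr0; congr (_ - _).
  by rewrite -!(scalerAl, scalerAr) linearZ /= !mulrA.
by move: M1; rewrite M2 => /eqP; rewrite subr_eq addrAC eq_sym subr_eq => /eqP.
Qed.

(** Compares the two ways of reversing three letters. The word values cancel; the bracket terms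
    cancel by the super Jacobi identity and the relations in shorter words. *)
Lemma defect_hexagon n a i j k b : defect_free n ->
  (size a + size b + 2 <= n)%N ->
  defect a i j (k :: b) + sg i j * defect (a ++ [:: j]) i k b
    + sg i j * sg i k * defect a j k (i :: b)
  = defect (a ++ [:: i]) j k b + sg j k * defect a i k (j :: b)
    + sg j k * sg i k * defect (a ++ [:: k]) i j b.
Proof.
move=> dn sz; rewrite !defectE -!catA /= !word_cat !word_cons.
rewrite !word_nil !mulr1 !mulrA.
have z a' b' x y : x \in comp g a' -> y \in comp g b' ->
    value (word a * super_rel a' b' x y * word b) = 0.
  by move=> xa yb; exact: (defect_free_rel dn xa yb sz (words_upto_word _)
    (words_upto_word _)).
have {z}zE a' b' x y : x \in comp g a' -> y \in comp g b' ->
    value (word a * hat x * hat y * word b)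
    = ssign a' b' * value (word a * hat y * hat x * word b)
      + value (word a * hat (br x y) * word b).
  move=> xa yb; have := z _ _ _ _ xa yb; rewrite /super_rel.
  rewrite !(mulrBr, mulrBl) !linearB /= -!(scalerAl, scalerAr) linearZ /= !mulrA.
  by move/eqP; rewrite subr_eq0 subr_eq addrC => /eqP.
have eij := br_even (e_comp i) (e_comp j).
have eik := br_even (e_comp i) (e_comp k).
have ejk := br_even (e_comp j) (e_comp k).
have := zE _ _ _ _ eij (e_comp k).
have := zE _ _ _ _ eik (e_comp j).
have := zE _ _ _ _ (e_comp i) ejk.
rewrite (br_jacobi (e_comp i) (e_comp j) (e_comp k)).
rewrite (br_skew eik (e_comp j)) !hat_e.
have JD c x y : value (word a * hat (x + c *: y) * word b)
    = value (word a * hat x * word b) + c * value (word a * hat y * word b).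
  by rewrite addrC hat_linear mulrDr mulrDl -scalerAr -scalerAl linearP addrC.
have JN c x : value (word a * hat (- (c *: x)) * word b)
    = - (c * value (word a * hat x * word b)).
  by rewrite -scaleNr linearZ -scalerAr -scalerAl linearZ; exact: mulNr.
rewrite JD JN => {zE JD JN eij eik ejk}.
move: (value _) (value _) (value _) (value _) (value _) (value _) (value _) (value _).
move=> t0 t1 t2 t3 t4 t5 t6 t7 -> -> ->; rewrite /ssign.
by case: (d i) (d j) (d k) => [] [] []; rewrite /= ?expr0 ?expr1; ring.
Qed.

Lemma mulrn_eq0_id (x : K) n : x *+ n.+1 = 0 -> x = 0.
Proof. by move/eqP; rewrite mulrn_eq0 => /eqP. Qed.

(* Induction on the number of inversions.  A descent to the right of the first
   one either is disjoint from it or overlaps it, and then the square or the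
   hexagon identity applies; equal odd letters make the unknown defect occur
   several times in the identity, whence the division by 2 or 3. *)
Lemma defect_descent n a i j b : defect_free n ->
  (size a + size b + 2 = n.+1)%N -> descent i j -> defect a i j b = 0.
Proof.
move=> dn; have [m] := ubnP (inversions lt (a ++ i :: j :: b)).
elim: m a i j b => // m IHm a i j b; rewrite ltnS => inv_m sz ij.
have IH a' i' j' b' : (size a' + size b' + 2 = n.+1)%N -> descent i' j' ->
    (inversions lt (a' ++ i' :: j' :: b') < inversions lt (a ++ i :: j :: b))%N ->
    defect a' i' j' b' = 0.
  by move=> sz' ij' inv'; apply: IHm => //; apply: leq_trans inv' inv_m.
case E: (first_descent (a ++ i :: j :: b)) => [[[[a0 i0] j0] b0]|]; last first.
  have := first_descent_None E; rewrite sorted_cat_cons /= ij /=.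
  by rewrite andbF.
have [es ij0] := first_descentP E.
have D0 := defect_first E.
have := first_descent_min E erefl ij; rewrite leq_eqVlt => /orP[/eqP sza|lt_sz].
  move/eqP: es; rewrite eqseq_cat ?sza // => /andP[/eqP -> /eqP[-> -> ->]].
  exact: D0.
case: (word_overlap (esym es) lt_sz) => [[ea ei eb]|[c [ea eb]]]; subst a b0.
  subst i; rewrite -cats1 in sz IH es *.
  have sz' : (size a0 + size b + 2 <= n)%N by move: sz; rewrite size_cat /=; lia.
  have := defect_hexagon i0 j0 j dn sz'; rewrite D0 add0r.
  rewrite -catA /= in IH.
  have szl x : (size (a0 ++ [:: x]) + size b + 2 = n.+1)%N.
    by move: sz; rewrite !size_cat.
  have szr x : (size a0 + size (x :: b) + 2 = n.+1)%N.
    by move: sz; rewrite !size_cat /=; lia.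
  have sw x y t : lt y x ->
      (inversions lt (a0 ++ y :: x :: t) < inversions lt (a0 ++ x :: y :: t))%N.
    by move=> yx; rewrite (inversions_swap lt_asym _ _ yx).
  have sw' z x y t : lt y x -> (inversions lt (a0 ++ z :: y :: x :: t)
      < inversions lt (a0 ++ z :: x :: y :: t))%N.
    move=> yx; have := inversions_swap lt_asym (a0 ++ [:: z]) t yx.
    by rewrite -!catA /= => ->.
  have IHl x y z : descent y z -> (inversions lt (a0 ++ x :: y :: z :: b)
      < inversions lt (a0 ++ [:: i0, j0, j & b]))%N -> defect (a0 ++ [:: x]) y z b = 0.
    by move=> yz inv; apply: IH; rewrite ?szl // -catA.
  have IHr x y z : descent x y -> (inversions lt (a0 ++ x :: y :: z :: b)
      < inversions lt (a0 ++ [:: i0, j0, j & b]))%N -> defect a0 x y (z :: b) = 0.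
    by move=> xy inv; apply: IH; rewrite ?szr.
  case: (eqVneq i0 j0) ij0 => [e0|n0 ij0].
    subst i0; rewrite (descent_eq _ lt_asym) => dj0.
    have s1 : sg j0 j0 = -1 by rewrite /ssign dj0.
    case: (eqVneq j0 j) ij => [e1 _|n1 ij].
      subst j; rewrite s1 D0 => /eqP; rewrite -subr_eq0 => /eqP h.
      (* Three equal odd letters turn the hexagon into -x = x + x, hence 3x = 0. *)
      by apply: (@mulrn_eq0_id _ 2); rewrite -[RHS]oppr0 -h; ring.
    have ji : lt j j0 by case/orP: ij => // /andP[]; rewrite (negPf n1).
    rewrite s1 (IHr j0 j j0) ?lt_descent ?sw' // (IHl j j0 j0) ?(descent_eq _ lt_asym) //; last first.
      exact: ltn_trans (sw _ _ _ ji) (sw' _ _ _ _ ji).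
    rewrite !mulr0 !addr0 mulN1r => /eqP; rewrite eq_sym -addr_eq0 -mulr2n => /eqP.
    exact: mulrn_eq0_id.
  have lt0 : lt j0 i0 by case/orP: ij0 => // /andP[]; rewrite (negPf n0).
  case: (eqVneq j0 j) ij => [e1|n1 ij].
    subst j; rewrite (descent_eq _ lt_asym) => dj0.
    rewrite D0 (IHl j0 i0 j0) ?lt_descent ?sw // (IHr j0 j0 i0) ?(descent_eq _ lt_asym) //.
      by rewrite !mulr0 !addr0 => <-.
    exact: ltn_trans (sw' _ _ _ _ lt0) (sw _ _ _ lt0).
  have lt1 : lt j j0 by case/orP: ij => // /andP[]; rewrite (negPf n1).
  have lt2 : lt j i0 by exact: lt_trans lt0.
  rewrite (IHl j0 i0 j) ?lt_descent ?sw // (IHr j0 j i0) ?lt_descent //; last first.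
    exact: ltn_trans (sw' _ _ _ _ lt2) (sw _ _ _ lt0).
  rewrite (IHr i0 j j0) ?lt_descent ?sw' // (IHl j i0 j0) ?lt_descent //; last first.
    exact: ltn_trans (sw _ _ _ lt2) (sw' _ _ _ _ lt1).
  by rewrite !mulr0 !addr0 => <-.
have sz' : (size a0 + size c + size b + 3 <= n)%N.
  by move: sz; rewrite size_cat /=; lia.
have := defect_square i0 j0 i j dn sz'; rewrite D0 add0r.
(* Exchanging [i] and [j] either removes an inversion or, for [i = j], gives back the original word,
   whose first defect is zero. *)
have -> : sg i j * defect a0 i0 j0 (c ++ [:: j, i & b]) = 0.
  case: (eqVneq i j) ij => [e1 _|n1 ij].
    by subst j; rewrite D0 mulr0.
  have lt1 : lt j i by case/orP: ij => // /andP[]; rewrite (negPf n1).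
  rewrite IH ?mulr0 //.
    by move: sz; rewrite !size_cat /=; lia.
  have := inversions_swap lt_asym (a0 ++ i0 :: j0 :: c) b lt1.
  by rewrite -!catA /= => ->.
rewrite addr0; case: (eqVneq i0 j0) ij0 => [e0|n0 ij0].
  subst i0; rewrite (descent_eq _ lt_asym) => dj0.
  rewrite /ssign dj0 /= expr1 mulN1r => /eqP.
  rewrite eq_sym -addr_eq0 -mulr2n => /eqP; exact: mulrn_eq0_id.
have lt0 : lt j0 i0 by case/orP: ij0 => // /andP[]; rewrite (negPf n0).
rewrite IH ?mulr0 //.
  by move: sz; rewrite !size_cat.
by rewrite -!catA /= (inversions_swap lt_asym _ _ lt0).
Qed.

(** Skew-symmetry of the bracket passes to the relation, so a pair that is not a descent reduces to
    one that is, or to two equal even letters. *)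
Lemma defect_skew a i j b : defect a i j b = - (sg i j * defect a j i b).
Proof.
have -> : defect a j i b = word_value (a ++ j :: i :: b)
    - sg i j * word_value (a ++ i :: j :: b)
    - value (word a * hat (br (e j) (e i)) * word b).
  by rewrite defectE /ssign andbC.
rewrite defectE (br_skew (e_comp i) (e_comp j)) -scaleNr linearZ /=.
rewrite -scalerAr -scalerAl linearZ /=; move: (value _) => t.
have -> : (- sg i j) *: t = - sg i j * t by [].
by rewrite /ssign; case: (d i && d j); rewrite /= ?expr0 ?expr1; ring.
Qed.

Lemma all_defect_free n : defect_free n.
Proof.
elim: n => [|n IHn] a i j b; first by rewrite addn2.
rewrite leq_eqVlt => /orP[/eqP sz|]; last by rewrite ltnS; exact: IHn.
have [ij|nij] := boolP (descent i j); first exact: defect_descent IHn sz ij.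
rewrite defect_skew; have [ji|nji] := boolP (descent j i).
  by rewrite (defect_descent IHn sz ji) mulr0 oppr0.
have eij : i = j.
  apply/eqP/negPn/negP => /lt_total.
  by case/orP => h; [case/negP: nji | case/negP: nij]; exact: lt_descent.
subst j; move: nij; rewrite (descent_eq _ lt_asym) => /negPf di.
(* For equal even letters skew-symmetry reads x = -x. *)
have := defect_skew a i i b; rewrite /ssign di /= expr0 mul1r => h.
have : defect a i i b *+ 2 = 0 by rewrite mulr2n {1}h addNr.
by move/mulrn_eq0_id->; rewrite oppr0.
Qed.

Lemma value_rel a b x y u v : x \in comp g a -> y \in comp g b ->
  (exists n, u \in words_upto n) -> (exists n, v \in words_upto n) ->
  value (u * super_rel a b x y * v) = 0.
Proof.
move=> xa yb [l ul] [m vm].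
exact: (defect_free_rel (@all_defect_free (l + m + 2)) xa yb _ ul vm).
Qed.

(** * Values of words ending in the subalgebra *)

Definition chi_ext (x : g) : K^o := free_lift (chi : I -> K^o) (co x).
Lemma chi_ext_linear : linear chi_ext.
Proof. by move=> c x y; rewrite /chi_ext !linearP. Qed.

Lemma chi_ext_e i : chi_ext (e i) = chi i.
Proof. by rewrite /chi_ext co_e free_liftU. Qed.

Lemma word_value_sorted s : first_descent s = None -> word_value s = base_value s.
Proof. by rewrite /word_value; case: (weight s) => //= n ->. Qed.

(** The letters of [H] come last, so a descent can neither lie in the sorted prefix nor straddle the
    boundary. *)
Lemma descent_in_tail c w a i j b : all (predC H) c ->
  sorted (fun i j => ~~ descent i j) c -> all H w ->
  c ++ w = a ++ i :: j :: b -> descent i j ->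
  exists2 w1, a = c ++ w1 & w = w1 ++ i :: j :: b.
Proof.
move=> + + wH; elim: c a => [|x c IHc] a /=; first by exists a.
case/andP=> xH cH cs; case: a => [|y a] /= [<- e1] ij; last first.
  have [|w1 -> ->] := IHc a cH _ e1 ij; last by exists w1.
  by case: (c) cs => //= z t /andP[].
case: c {IHc} cH cs e1 => [_ _ /= e1|z c _ /=]; last first.
  by case/andP=> nd _ [ez _]; rewrite ez ij in nd.
have jH : H j by move: wH; rewrite e1 => /andP[].
case/negP: xH; case/orP: ij => [ji|/andP[/eqP-> _]//].
exact: H_upper jH ji.
Qed.

(** Rewriting happens inside [w] only, and the product of the [chi k] respects each step: swaps
    preserve it, and [chi] vanishes on brackets and on odd letters. *)
Lemma word_value_H c w : all (predC H) c ->
  sorted (fun i j => ~~ descent i j) c -> all H w ->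
  word_value (c ++ w) = (nilp c)%:R * \prod_(k <- w) chi k.
Proof.
move=> cH cs; have [m] := ubnP (weight (c ++ w)).
elim: m w => // m IHm w; rewrite ltnS => wm wH.
case E: (first_descent (c ++ w)) => [[[[a i] j] b]|]; last first.
  rewrite (word_value_sorted E) /base_value all_cat wH andbT.
  case: (c) cH => [_|x t /= /andP[/negPf-> _]]; first by rewrite mul1r.
  by rewrite mul0r.
have [es ij] := first_descentP E.
have [w1 ea ew] := descent_in_tail cH cs wH es ij; subst a w.
have [w1H iH jH bH] : [/\ all H w1, H i, H j & all H b].
  by move: wH; rewrite all_cat /= => /and4P[].
have t0 : value (word (c ++ w1) * hat (br (e i) (e j)) * word b) = 0.
  pose V0 : K := (nilp c)%:R * (\prod_(k <- w1) chi k * \prod_(k <- b) chi k).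
  suff -> : value (word (c ++ w1) * hat (br (e i) (e j)) * word b)
      = V0 * chi_ext (br (e i) (e j)) by rewrite /chi_ext chi_br // mulr0.
  move: (br _ _) (H_br iH jH); apply: span_ind => [|r x y IHx IHy|_ [k kH ->]].
  - by rewrite linear0 mulr0 mul0r linear0 (linearf0 chi_ext_linear) mulr0.
  - rewrite hat_linear mulrDr mulrDl -scalerAr -scalerAl linearP IHx IHy.
    by rewrite chi_ext_linear mulrDr; congr (_ + _); exact: mulrCA.
  rewrite hat_e chi_ext_e -mulrA -word_cons -word_cat value_word -catA.
  rewrite IHm; last by rewrite all_cat /= w1H kH.
    by rewrite big_cat big_cons /V0 /= -!mulrA [chi k * _]mulrC.
  apply: leq_trans wm; apply: weight_size => //.
  by rewrite !size_cat /= !ltn_add2l.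
rewrite (word_valueE E) t0; case: eqVneq ij => [eij|nij].
  subst j; rewrite (descent_eq _ lt_asym) => /chi_odd_eq0 ci.
  by rewrite mul0r big_cat !big_cons /= ci mul0r !mulr0.
case/orP=> [ji|/andP[/eqP ei _]]; last by rewrite ei eqxx in nij.
rewrite addr0 -catA IHm; last by rewrite all_cat /= w1H iH jH.
  rewrite !big_cat !big_cons /= /ssign.
  case di: (d i) => /=; first by rewrite (chi_odd_eq0 di) !(mul0r, mulr0).
  by rewrite expr0 mul1r [chi j * _]mulrCA.
apply: leq_trans wm; rewrite !catA; exact: weight_swap.
Qed.

Lemma sorted_split s : sorted (fun i j => ~~ descent i j) s -> exists c w,
  [/\ s = c ++ w, all (predC H) c, sorted (fun i j => ~~ descent i j) c & all H w].
Proof.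
elim: s => [|x s IHs] xs; first by exists [::], [::].
have [|c [w [es cH cs wH]]] := IHs; first by case: (s) xs => //= y t /andP[].
have [xH|nxH] := boolP (H x).
  exists [::], (x :: s); split=> //; rewrite es in xs *.
  case: c cH xs {es cs} => [_ _|y c /= /andP[yH _] /andP[nd _]]; first by rewrite /= xH.
  case/negP: yH; have [<-//|xy] := eqVneq x y.
  case/orP: (lt_total xy) => [|yx]; first exact: H_upper.
  by rewrite lt_descent in nd.
exists (x :: c), w; rewrite es; split=> //=; first by rewrite nxH.
by move: xs cs; rewrite es; case: (c) => //= y t /andP[-> _] ->.
Qed.

(** As all defects vanish, the first descent of [a] can be rewritten in [a] and in [a ++ [:: j]]
    alike, down to a sorted [a], whose letters in [H] form a suffix. *)
Lemma word_value_rcons a j : H j -> word_value (a ++ [:: j]) = word_value a * chi j.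
Proof.
move=> jH; have [m] := ubnP (weight a); elim: m a => // m IHm a; rewrite ltnS => am.
case E: (first_descent a) => [[[[a1 k] l] a2]|]; last first.
  have [c [w [es cH cs wH]]] := sorted_split (first_descent_None E).
  rewrite es -catA !word_value_H // ?all_cat ?wH /= ?jH //.
  by rewrite big_cat big_seq1 /= mulrA.
have [es kl] := first_descentP E.
have d0 b : defect a1 k l b = 0 by exact: (@all_defect_free _ _ _ _ _ (leqnn _)).
have := d0 a2; have := d0 (a2 ++ [:: j]); rewrite !defectE.
have -> : value (word a1 * hat (br (e k) (e l)) * word (a2 ++ [:: j]))
    = value (word a1 * hat (br (e k) (e l)) * word a2) * chi j.
  rewrite !value_hat /free_lift mulr_suml; apply: eq_bigr => q _.
  have -> : a1 ++ q :: a2 ++ [:: j] = (a1 ++ q :: a2) ++ [:: j] by rewrite -catA.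
  rewrite IHm; first exact: mulrA.
  apply: leq_trans am; apply: weight_size => //.
  by rewrite es !size_cat /= ltn_add2l.
have cE x y : a1 ++ [:: x, y & a2 ++ [:: j]] = (a1 ++ [:: x, y & a2]) ++ [:: j].
  by rewrite -catA.
rewrite !cE -es; move: (value _) => t.
case: (eqVneq k l) kl => [ekl|nkl].
  subst l; rewrite (descent_eq _ lt_asym) => dk; rewrite -es /ssign dk /= expr1.
  move: (word_value (a ++ [:: j])) (word_value a) => y z h1 h2.
  (* For an equal odd pair the relation determines twice the value. *)
  apply/eqP; rewrite -subr_eq0; apply/eqP/(@mulrn_eq0_id _ 1).
  have -> : (y - z * chi j) *+ 2
      = (y - -1 * y - t * chi j) - (z - -1 * z - t) * chi j by ring.
  by rewrite h1 h2 mul0r subr0.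
case/orP=> [lk|/andP[/eqP ek _]]; last by rewrite ek eqxx in nkl.
rewrite (IHm (a1 ++ [:: l, k & a2])); last by apply: leq_trans am; rewrite es; exact: weight_swap.
move: (word_value (a ++ [:: j])) (word_value (a1 ++ [:: l, k & a2])) => x y.
move: (word_value a) (ssign _ _) => z r h1 h2.
apply/eqP; rewrite -subr_eq0; apply/eqP.
have -> : x - z * chi j
    = (x - r * (y * chi j) - t * chi j) - (z - r * y - t) * chi j by ring.
by rewrite h1 h2 mul0r subr0.
Qed.

(** * The cyclic module defined by the functional *)

Hypothesis word_span : forall u, u \in span (fun v => exists s, v = word s).

Lemma words_upto_exists u : exists n, u \in words_upto n.
Proof.
move: u (word_span u); apply: span_ind => [|c u v [m um] [n vn]|_ [s ->]].
- by exists 0%N; rewrite rpred0.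
- have mono k l w : (k <= l)%N -> w \in words_upto k -> w \in words_upto l.
    move=> kl; move: w; apply: span_ind => [|r x y IHx IHy|_ [s sk ->]].
    + exact: rpred0.
    + exact: subspaceZD.
    + by apply: span_gen; exists s => //; exact: leq_trans kl.
  exists (maxn m n); apply: subspaceZD.
    by apply: mono um; exact: leq_maxl.
  by apply: mono vn; exact: leq_maxr.
- by exists (size s); exact: words_upto_word.
Qed.

Lemma value_gen u i : H i -> value (u * gen i) = chi i * value u.
Proof.
move=> iH; move: u (word_span u); apply: span_ind => [|c u v IHu IHv|_ [s ->]].
- by rewrite mul0r linear0 mulr0.
- rewrite mulrDl -scalerAl !linearP IHu IHv mulrDr; congr (_ + _).
  exact: mulrCA.
- by rewrite -word_cat !value_word word_value_rcons // mulrC.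
Qed.

Lemma value1 : value 1 = 1.
Proof.
by rewrite -word_nil value_word word_value_sorted // /base_value /= big_nil.
Qed.

(** The largest left ideal inside the kernel of the functional; the model is the quotient by it,
    with left multiplication as action. *)
Definition value_ker : subspace A.
Proof.
apply: (@subspace_of K A (fun u => forall v, value (v * u) = 0)).
- by move=> v; rewrite mulr0 linear0.
- move=> c u w hu hw v; rewrite mulrDr -scalerAr linearP hu hw.
  by rewrite scaler0 addr0.
Defined.

Lemma value_kerP u : u \in value_ker <-> forall v, value (v * u) = 0.
Proof. by split=> [/asboolP|h]; last exact/asboolP. Qed.

Definition model_act (x : g) (q : lquot value_ker) : lquot value_ker :=
  lproj value_ker (hat x * lrepr q).

Lemma model_act_proj x u :
  model_act x (lproj value_ker u) = lproj value_ker (hat x * u).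
Proof.
apply/lprojP; rewrite -mulrBr; apply/value_kerP => v; rewrite mulrA.
by move/value_kerP: (lrepr_proj value_ker u); apply.
Qed.

(** The relations act by zero because the functional kills their two-sided multiples. The class of 1
    is nonzero since [value 1 = 1], and [value_gen] makes it an eigenvector. *)
Lemma basis_character_model : exists (W : lmodType K) (T : g -> W -> W) (w : W),
  [/\ forall x, linear (T x), forall m, linear (T^~ m),
      forall a b x y m, x \in comp g a -> y \in comp g b ->
        T (br x y) m = T x (T y m) - ssign a b *: T y (T x m),
      w != 0 & forall i, H i -> T (e i) w = chi i *: w].
Proof.
exists (lquot value_ker), model_act, (lproj value_ker 1); split.
- move=> x c q r; rewrite -[q]lreprK -[r]lreprK -linearP !model_act_proj.
  by rewrite mulrDr -scalerAr linearP.
- move=> q c x y; rewrite -[q]lreprK !model_act_proj hat_linear mulrDl -scalerAl.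
  by rewrite linearP.
- move=> a b x y q xa yb; rewrite -[q]lreprK; move: (lrepr q) => u.
  rewrite !model_act_proj -linearZ -linearB; apply/lprojP/value_kerP => v.
  have -> : hat (br x y) * u - (hat x * (hat y * u) - ssign a b *: (hat y * (hat x * u)))
      = - (super_rel a b x y * u).
    by rewrite -opprB; congr (- _); rewrite /super_rel !mulrBl -scalerAl !mulrA.
  by rewrite mulrN linearN /= mulrA value_rel ?oppr0 //; exact: words_upto_exists.
- apply/eqP => /lproj0P/value_kerP/(_ 1).
  by rewrite mulr1 value1 => /eqP; rewrite oner_eq0.
- move=> i iH; rewrite model_act_proj mulr1 hat_e -linearZ.
  apply/lprojP/value_kerP => v; rewrite mulrBr linearB /= value_gen //.
  by rewrite -scalerAr mulr1 linearZ subrr.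
Qed.
End PBW.

(** * Homogeneous bases adapted to a subalgebra *)

(** A well-order is rearranged so that [H] comes first; a basis chosen greedily along it is then
    adapted to a subalgebra taken as [H]. *)
Lemma strict_well_order_initial (T : eqType) (H : pred T) : exists lt : rel T,
  [/\ irreflexive lt, transitive lt, forall x y, x != y -> lt x y || lt y x,
      forall x y, lt x y -> H y -> H x
    & forall P : T -> Prop, (forall x, (forall y, lt y x -> P y) -> P x) ->
        forall x, P x].
Proof.
have [R Rwo] := well_ordering_principle T.
have wo : wo_chain R predT by exact: withinW.
have Rtot x y : R x y || R y x by exact: (wo_chainW wo).
have Ranti x y : R x y -> R y x -> x = y.
  by move=> xy yx; apply: (wo_chain_antisymmetric wo) => //; rewrite xy yx.
have Rmin (P : T -> Prop) : (exists x, P x) ->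
    exists2 x, P x & forall y, P y -> R x y.
  case=> x Px; have [|z [[zP lb] _]] := Rwo [pred x | `[< P x >]].
  - by exists x; exact/asboolP.
  - by exists z; [exact/asboolP | move=> y Py; apply: lb; exact/asboolP].
(* Transitivity comes from the least element of [x], [y], [z]. *)
have Rtrans : transitive R.
  move=> y x z xy yz.
  have [t tP tm] := Rmin (fun t => [\/ t = x, t = y | t = z]) (ex_intro _ x (Or31 _ _ erefl)).
  case: tP => et; subst t; first by apply: tm; constructor 3.
    suff -> : x = y by [].
    by apply: Ranti => //; apply: tm; constructor 1.
  suff ezy : z = y by subst z.
  by apply: Ranti => //; apply: tm; constructor 2.
pose lt x y := if H x == H y then R x y && (x != y) else H x.
have Hlt x y : lt x y -> H y -> H x.
  by rewrite /lt; case: eqP => [->|].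
exists lt; split=> //.
- by move=> x; rewrite /lt eqxx eqxx andbF.
- move=> y x z; rewrite /lt.
  case: (H x) (H y) (H z) => [] [] [] //=.
  + move=> /andP[xy nxy] /andP[yz nyz]; rewrite (Rtrans y) //=.
    by apply: contraNneq nxy => exz; subst z; rewrite (Ranti x y).
  + move=> /andP[xy nxy] /andP[yz nyz]; rewrite (Rtrans y) //=.
    by apply: contraNneq nxy => exz; subst z; rewrite (Ranti x y).
- move=> x y nxy; rewrite /lt (eq_sym (H y)) (eq_sym y) nxy !andbT.
  by case: (H x) (H y) => [] [] //=; exact: Rtot.
move=> P IH.
(* A least counterexample for [R], sought first in [H] and then in its complement; on each of them
   [lt] is the strict part of [R]. *)
have min (Q : pred T) : (forall x y, lt y x -> Q x -> Q y \/ P y) ->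
    (forall x y, Q x -> Q y -> H x = H y) -> forall x, Q x -> P x.
  move=> Qlow Qcst x Qx; apply: contrapT => nPx.
  have [|z [Qz nPz] zm] := Rmin (fun z => Q z /\ ~ P z); first by exists x.
  apply: nPz; apply: IH => y yz; apply: contrapT => nPy.
  case: (Qlow _ _ yz Qz) => // Qy; move: yz; rewrite /lt (Qcst y z) // eqxx.
  by case/andP=> Ryz; rewrite (Ranti y z) ?eqxx //; exact: zm.
have PH x : H x -> P x.
  apply: min => [y z /Hlt zy /zy|y z ->]; first by left.
  by move->.
move=> x; case: (boolP (H x)) => [/PH//|].
apply: (min (predC H)) => [y z zy nHy|y z /negPf-> /negPf->//].
by case: (boolP (H z)) => [/PH|]; [right | left].
Qed.

Section HomogeneousBasis.
Variables (K : numFieldType) (g : lieSuperalgebra K) (h : gradedSubalgebra g).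
Variable lt : rel g.
Hypothesis lt_trans : transitive lt.
Hypothesis lt_total : forall x y, x != y -> lt x y || lt y x.
Hypothesis lt_h : forall x y, lt x y -> y \in subspace_pred h -> x \in subspace_pred h.
Hypothesis lt_ind : forall P : g -> Prop,
  (forall x, (forall y, lt y x -> P y) -> P x) -> forall x, P x.

Definition homogeneous (x : g) := exists a, x \in comp g a.

(** Transfinite choice of a basis: a homogeneous element is kept when the smaller ones do not span
    it. *)
Definition greedy (x : g) := homogeneous x /\
  x \notin span (fun y => homogeneous y /\ lt y x).

Definition basis_index : Type := {x : g | `[< greedy x >]}.
HB.instance Definition _ := Choice.on basis_index.

Definition basis (i : basis_index) : g := val i.

Lemma basis_greedy i : greedy (basis i).
Proof. exact/asboolP/(valP i). Qed.

Lemma span_sub (X Y : g -> Prop) : (forall x, X x -> x \in span Y) ->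
  forall x, x \in span X -> x \in span Y.
Proof.
move=> XY; apply: span_ind => //; first exact: rpred0.
by move=> c u v; exact: subspaceZD.
Qed.

(** Well-founded induction. The bound by [x] matters: for [x] in an initial segment the basis
    elements used stay in that segment. *)
Lemma greedy_span x : homogeneous x ->
  x \in span (fun y => exists2 i, y = basis i & basis i = x \/ lt (basis i) x).
Proof.
elim/lt_ind: x => x IHx hx.
have [gx|ngx] := pselect (greedy x).
  apply: span_gen; have gx' : `[< greedy x >] by exact/asboolP.
  by exists (Sub x gx' : basis_index); rewrite ?/basis ?SubK; [|left].
have : x \in span (fun y => homogeneous y /\ lt y x).
  by apply: contrapT => /negP nx; apply: ngx.
apply: span_sub => y [hy yx]; move: (IHx y yx hy); apply: span_sub => z [i -> iy].
apply: span_gen; exists i => //; right.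
by case: iy => [->//|iy]; exact: lt_trans yx.
Qed.

Definition parity (i : basis_index) : bool := `[< basis i \in comp g true >].

Lemma basis_comp i : basis i \in comp g (parity i).
Proof.
rewrite /parity; case: asboolP => // n1.
by have [[[] //]] := basis_greedy i.
Qed.

Lemma comp_span (X : g -> Prop) a x : (forall y, X y -> homogeneous y) ->
  x \in comp g a -> x \in span X -> x \in span (fun y => X y /\ y \in comp g a).
Proof.
move=> Xh xa xX.
pose S b := span (fun y => X y /\ y \in comp g b).
have Scomp b y : y \in S b -> y \in comp g b.
  move: y; apply: span_ind => [|c u v|y []] //; first exact: rpred0.
  exact: subspaceZD.
have [x0 [x1 [x0S x1S ex]]] : exists x0 x1, [/\ x0 \in S false, x1 \in S true & x = x0 + x1].
  move: x xX {xa}; apply: span_ind => [|c _ _ [u0 [u1 [u0S u1S ->]]] [v0 [v1 [v0S v1S ->]]]|y Xy].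
  - by exists 0, 0; rewrite !rpred0 addr0.
  - by exists (c *: u0 + v0), (c *: u1 + v1); rewrite !subspaceZD // scalerDr addrACA.
  case: (Xh y Xy) => -[] yb.
    by exists 0, y; rewrite rpred0 add0r; split=> //; exact: span_gen.
  by exists y, 0; rewrite rpred0 addr0; split=> //; exact: span_gen.
have c0 := Scomp _ _ x0S; have c1 := Scomp _ _ x1S.
case: a xa => xa; rewrite -/(S _).
  have : 0 + x = x0 + x1 by rewrite add0r.
  by case/comp_uniq; rewrite ?rpred0 // => _ ->.
have : x + 0 = x0 + x1 by rewrite addr0.
by case/comp_uniq; rewrite ?rpred0 // => ->.
Qed.

Lemma basis_span a x : x \in comp g a ->
  x \in span (fun y => exists2 i, parity i = a & y = basis i).
Proof.
move=> xa.
have xX : x \in span (fun y => exists i, y = basis i).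
  have /greedy_span : homogeneous x by exists a.
  by apply: span_sub => y [i -> _]; apply: span_gen; exists i.
have Xh y : (exists i, y = basis i) -> homogeneous y.
  by case=> i ->; have [] := basis_greedy i.
move: (comp_span Xh xa xX); apply: span_sub => _ [[i ->] ia]; apply: span_gen.
have [e|ne] := eqVneq (parity i) a; first by exists i.
(* A basis element lying in both components would be zero, against greediness. *)
have ip := basis_comp i; have [_ /negP[]] := basis_greedy i.
suff -> : basis i = 0 by exact: rpred0.
by case: a (parity i) ia ip ne {xa} => -[] // i1 i2 _; apply: comp_direct.
Qed.

Lemma basis_span_sub y : y \in subspace_pred h ->
  y \in span (fun z => exists2 i, basis i \in subspace_pred h & z = basis i).
Proof.
case/subalg_graded => y0 [y1 [y0h y1h y0g y1g ->]].
have hom z a : z \in subspace_pred h -> z \in comp g a ->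
    z \in span (fun z => exists2 i, basis i \in subspace_pred h & z = basis i).
  move=> zh za; have /greedy_span : homogeneous z by exists a.
  apply: span_sub => _ [i -> iz]; apply: span_gen; exists i => //.
  by case: iz => [->//|/lt_h]; exact.
by rewrite rpredD //; [exact: hom y0g | exact: hom y1g].
Qed.

Lemma max_basis_index (s : seq basis_index) : s != [::] ->
  exists2 k, k \in s & forall l, l \in s -> l != k -> lt (basis l) (basis k).
Proof.
elim: s => // x s IHs _; have [->|/IHs [k ks km]] := eqVneq s [::].
  by exists x; rewrite ?mem_head // => l; rewrite inE => /eqP->; rewrite eqxx.
have [exk|nxk] := eqVneq x k.
  exists k; first by rewrite inE ks orbT.
  by move=> l; rewrite inE => /orP[/eqP->|/km//]; rewrite exk eqxx.
have /lt_total/orP[xk|kx] : basis x != basis k by rewrite (inj_eq val_inj).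
  exists k; first by rewrite inE ks orbT.
  by move=> l; rewrite inE => /orP[/eqP->|/km//].
exists x; first exact: mem_head.
move=> l; rewrite inE => /orP[/eqP->|ls _]; first by rewrite eqxx.
have [->//|lk] := eqVneq l k; exact: lt_trans (km l ls lk) kx.
Qed.

(** The largest index in the support would lie in the span of smaller elements, which greediness
    excludes. *)
Lemma basis_free (q : {malg K[basis_index]}) : free_lift basis q = 0 -> q = 0.
Proof.
move=> q0; apply: contrapT => nq.
have [|k kq km] := @max_basis_index (msupp q).
  apply/eqP => e; apply: nq; apply/malgP => k.
  rewrite mcoeff0 mcoeff_outdom //; apply/negP => kq.
  by have : k \in enum_fset (msupp q) by []; rewrite e.
have [_ /negP[]] := basis_greedy k.
have := q0; rewrite /free_lift (big_fsetD1 k kq) /= => /eqP.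
rewrite addr_eq0 => /eqP e.
have qk : q@_k != 0 by rewrite mcoeff_neq0.
suff : q@_k *: basis k \in span (fun y => homogeneous y /\ lt y (basis k)).
  by rewrite rpredZeq (negPf qk).
rewrite e rpredN big_seq rpred_sum // => l; rewrite in_fsetD1 => /andP[lk lq].
rewrite rpredZ //; apply: span_gen; split; last exact: km.
by have [] := basis_greedy l.
Qed.

Lemma basis_coord x : exists q : {malg K[basis_index]}, free_lift basis q = x.
Proof.
elim/comp_ind: x => [_ _ [q <-] [r <-]|a x xa].
  by exists (q + r); rewrite linearD.
move/basis_span: xa; move: x; apply: span_ind => [|c _ _ [q <-] [r <-]|_ [i _ ->]].
- by exists 0; rewrite linear0.
- by exists (c *: q + r); rewrite linearP.
- by exists << i >>; rewrite free_liftU.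
Qed.

Definition coord (x : g) : {malg K[basis_index]} := projT1 (cid (basis_coord x)).

Lemma coordK x : free_lift basis (coord x) = x.
Proof. exact: projT2 (cid (basis_coord x)). Qed.

Lemma basis_inj (q r : {malg K[basis_index]}) :
  free_lift basis q = free_lift basis r -> q = r.
Proof.
move=> e; apply/eqP; rewrite -subr_eq0; apply/eqP/basis_free.
by rewrite linearB /= e subrr.
Qed.

Lemma coord_linear : linear coord.
Proof. by move=> c x y; apply: basis_inj; rewrite linearP /= !coordK. Qed.

Lemma coord_basis i : coord (basis i) = << i >>.
Proof. by apply: basis_inj; rewrite coordK free_liftU. Qed.
End HomogeneousBasis.

(** * Words in the free algebra *)

Section FreeWords.
Variables (K : numFieldType) (I : choiceType).

Definition free_word (s : seq I) : free_alg K I := << FMonom s >>.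

Lemma free_word_nil : free_word [::] = 1.
Proof. by rewrite /free_word -fmoneE. Qed.

Lemma free_word_cat s t : free_word (s ++ t) = free_word s * free_word t.
Proof.
rewrite /free_word [RHS]malgUM.
suff -> : FMonom (s ++ t) = mmul (FMonom s) (FMonom t) by [].
by rewrite -[RHS]fmK fmM.
Qed.

Lemma free_word_span u : u \in span (fun v => exists s, v = free_word s).
Proof.
move: u; apply: malg_ind => [|c u v|[s]]; first exact: rpred0.
  exact: subspaceZD.
by apply: span_gen; exists s.
Qed.

Definition free_value (F : seq I -> K) : free_alg K I -> K^o :=
  free_lift (fun w : {fmonom I} => F w : K^o).

Lemma free_value_linear F : linear (free_value F).
Proof. exact: free_lift_is_linear. Qed.

Lemma free_value_word F s : free_value F (free_word s) = F s.
Proof. exact: free_liftU. Qed.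
End FreeWords.

(** * Realising a character by a nonzero eigenvector *)

Section CharacterModel.
Variables (K : numFieldType) (g : lieSuperalgebra K) (h : gradedSubalgebra g).
Variable chi : lsaHom h (scalar_lsa K).

(** Stands in for the Poincare-Birkhoff-Witt theorem: one such module suffices to show that the
    cyclic vector of the induced module is nonzero. *)
Lemma character_model : exists (W : lmodType K) (T : g -> W -> W) (w : W),
  [/\ forall x, linear (T x), forall m, linear (T^~ m),
      forall a b x y m, x \in comp g a -> y \in comp g b ->
        T (br x y) m = T x (T y m) - ssign a b *: T y (T x m),
      w != 0 & forall y : h, T (val y) w = (chi y : K) *: w].
Proof.
have [lt [lt_irr lt_trans lt_total lt_h lt_ind]] :=
  strict_well_order_initial (mem (subspace_pred h)).
pose I : choiceType := basis_index lt.
pose e : I -> g := @basis K g lt.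
pose d : pred I := @parity K g lt.
pose co : {linear g -> {malg K[I]}} := linear_pack (coord_linear lt_trans lt_total lt_ind).
have e_comp i : e i \in comp g (d i) by exact: basis_comp.
have e_span := basis_span lt_trans lt_ind.
have co_e i : co (e i) = << i >> by exact: coord_basis.
pose H : pred I := fun i => e i \in subspace_pred h.
pose chiI (i : I) : K := if insub (e i) is Some y then chi (y : h) else 0.
have H_span y : y \in subspace_pred h ->
    y \in span (fun z => exists2 i, H i & z = e i).
  exact: (basis_span_sub lt_trans lt_h lt_ind).
have chiIE (y : g) (yh : y \in subspace_pred h) :
    free_lift (chiI : I -> K^o) (co y) = chi (Sub y yh).
  (* The membership proof is quantified inside, so that span induction can carry it along. *)
  have [zh ->] : exists zh : y \in subspace_pred h,
      free_lift (chiI : I -> K^o) (co y) = chi (Sub y zh); last first.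
    by congr (chi _); apply: val_inj.
  move/H_span: yh; move: y; apply: span_ind.
  - exists (rpred0 _); rewrite !linear0.
    by rewrite -[LHS](linear0 chi); congr (chi _); apply: val_inj.
  - move=> c u v [uh eu] [vh ev]; exists (subspaceZD c uh vh).
    have -> : co (c *: u + v) = c *: co u + co v by exact: linearP.
    rewrite free_lift_is_linear eu ev -[LHS](linearP chi); congr (chi _).
    exact: val_inj.
  - move=> _ [i iH ->]; exists iH; rewrite co_e free_liftU /chiI insubT.
    by congr (chi _); apply: val_inj.
have H_br i j : H i -> H j -> br (e i) (e j) \in span (fun z => exists2 k, H k & z = e k).
  by move=> iH jH; apply: H_span; exact: subalg_br.
have chi_br i j : H i -> H j -> free_lift (chiI : I -> K^o) (co (br (e i) (e j))) = 0.
  move=> iH jH; rewrite (chiIE _ (subalg_br iH jH)).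
  transitivity (chi (br (Sub (e i) iH : h) (Sub (e j) jH : h))).
    by congr (chi _); exact: val_inj.
  by rewrite lsaHom_br.
have chi_odd i : d i -> chiI i = 0.
  move=> di; rewrite /chiI; case: insubP => // y _ ey; apply: chi_odd.
  by have := e_comp i; rewrite di -ey.
(* The order is reversed: [h] is initial in the well-order, while its letters must come last in
   words. *)
have ltI_asym i j : lt (e j) (e i) -> ~~ lt (e i) (e j).
  by move=> ji; apply/negP => /(lt_trans _ _ _ ji); rewrite lt_irr.
have ltI_trans : transitive (fun i j => lt (e j) (e i)).
  by move=> j i k ji kj; exact: lt_trans kj ji.
have ltI_total i j : i != j -> lt (e j) (e i) || lt (e i) (e j).
  by move=> ij; rewrite lt_total // (inj_eq val_inj) eq_sym.
have H_upper i j : H i -> lt (e j) (e i) -> H j.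
  by move=> iH ji; exact: lt_h ji iH.
have [W [T [w [Tr Tl Tbr w0 Tw]]]] := basis_character_model ltI_asym ltI_trans
  ltI_total e_comp e_span co_e H_upper H_br chi_br chi_odd
  (value := linear_pack (@free_value_linear K I _)) (@free_word_nil K I)
  (@free_word_cat K I) (@free_value_word K I _) (@free_word_span K I).
exists W, T, w; split=> // -[y yh].
rewrite -[(chi _ : K)](chiIE y yh) -[val _]/y.
move: y {yh} (H_span _ yh); apply: span_ind => [|c u v IHu IHv|_ [i iH ->]].
- by rewrite (linearf0 (Tl w)) !linear0 scale0r.
- rewrite Tl IHu IHv.
  have -> : co (c *: u + v) = c *: co u + co v by exact: linearP.
  by rewrite free_lift_is_linear scalerDl scalerA.
- by rewrite co_e free_liftU Tw.
Qed.
End CharacterModel.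

(** * Contraction by the ideal *)

Section Contraction.
Variables (K : numFieldType) (g : lieSuperalgebra K) (p : gradedIdeal g).
Variable phi : lsaHom p (scalar_lsa K).

Lemma ideal_brr (q : p) (x : g) : br (val q) x \in ideal_space p.
Proof.
have hom a b (q' x' : g) : q' \in ideal_space p -> q' \in comp g a ->
    x' \in comp g b -> br q' x' \in ideal_space p.
  by move=> q'p q'a x'b; rewrite (br_skew q'a x'b) rpredN rpredZ ?ideal_br.
have [q0 [q1 [q0p q1p q0g q1g ->]]] := ideal_graded (valP q).
have [x0 [x1 [x0g x1g ->]]] := comp_cover x.
rewrite (linearfD (br_linl _)) !(linearfD (br_linr _)).
by rewrite !rpredD //; [exact: hom q0g x0g | exact: hom q0g x1g
                       | exact: hom q1g x0g | exact: hom q1g x1g].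
Qed.

Definition ideal_rbracket (q : p) (x : g) : p :=
  Sub (br (val q) x) (ideal_brr q x).

Lemma ideal_rbracket_linl x : linear (ideal_rbracket^~ x).
Proof. by move=> c q r; apply: val_inj; exact: br_linl. Qed.
Lemma ideal_rbracket_linr q : linear (ideal_rbracket q).
Proof. by move=> c x y; apply: val_inj; exact: br_linr. Qed.

Definition pairing (q : p) (x : g) : K := phi (ideal_rbracket q x).

Lemma pairing_linl x c q r :
  pairing (c *: q + r) x = c * pairing q x + pairing r x.
Proof. by rewrite /pairing ideal_rbracket_linl linearP. Qed.
Lemma pairing_linr q c x y :
  pairing q (c *: x + y) = c * pairing q x + pairing q y.
Proof. by rewrite /pairing ideal_rbracket_linr linearP. Qed.

Lemma pairing_parity a b q x :
  q \in comp p a -> x \in comp g b -> a != b -> pairing q x = 0.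
Proof.
move=> qa xb ab; apply: chi_odd.
have <- : a (+) b = true by case: a b ab {qa xb} => -[].
exact: br_even.
Qed.

Lemma pairing0_annihilator a (x : g) : x \in comp g a ->
  (forall q, q \in comp p a -> pairing q x = 0) -> x \in annihilator_space phi.
Proof.
move=> xa x0; apply/annihilatorP => q.
elim/comp_ind: q => [q r IHq IHr|b q qb].
  by rewrite (linearfD (ideal_bracket_linr _)) linearD IHq IHr addr0.
have -> : ideal_bracket x q = - (ssign a b *: ideal_rbracket q x).
  by apply: val_inj; exact: (br_skew xa qb).
rewrite linearN linearZ /= -/(pairing q x).
have [eab|ab] := eqVneq b a; last by rewrite (pairing_parity qb xa ab) scaler0 oppr0.
by rewrite x0 -?eab // scaler0 oppr0.
Qed.

Definition dual_family (E : seq (g * p)) :=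
  forall e, e \in E -> exists a, e.1 \in comp g a /\ e.2 \in comp p a.

(** The pairs recover the elements of [X] modulo the annihilator, as dual bases would. *)
Definition adapted (E : seq (g * p)) (X : seq g) :=
  forall x, x \in X ->
    \sum_(e <- E) pairing e.2 x *: e.1 - x \in annihilator_space phi.

Lemma pairing_sumr q (E : seq (g * p)) (c : g * p -> K) :
  pairing q (\sum_(e <- E) c e *: e.1) = \sum_(e <- E) c e * pairing q e.1.
Proof.
elim: E => [|e E IHE]; last by rewrite !big_cons pairing_linr IHE.
by rewrite !big_nil /pairing (linearf0 (ideal_rbracket_linr _)) linear0.
Qed.

Lemma pairing_suml x (E : seq (g * p)) (c : g * p -> K) :
  pairing (\sum_(e <- E) c e *: e.2) x = \sum_(e <- E) c e * pairing e.2 x.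
Proof.
elim: E => [|e E IHE]; last by rewrite !big_cons pairing_linl IHE.
by rewrite !big_nil /pairing (linearf0 (ideal_rbracket_linl _)) linear0.
Qed.

Lemma annihilator_pairing q x : x \in annihilator_space phi -> pairing q x = 0.
Proof.
move=> /annihilator_graded [x0 [x1 [x0A x1A x0g x1g ->]]].
have hom a b y r : y \in comp g a -> r \in comp p b ->
    y \in annihilator_space phi -> pairing r y = 0.
  move=> ya rb /annihilatorP yA; rewrite /pairing.
  have -> : ideal_rbracket r y = - (ssign b a *: ideal_bracket y r).
    by apply: val_inj; exact: (@br_skew K g b a (val r) y).
  by rewrite linearN linearZ /= yA scaler0 oppr0.
have hom' a y r : y \in comp g a -> y \in annihilator_space phi -> pairing r y = 0.
  move=> ya yA; elim/comp_ind: r => [r s IHr IHs|b r rb]; last exact: hom ya rb yA.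
  by rewrite -[r]scale1r pairing_linl IHr IHs mulr0 addr0.
by rewrite -[x0]scale1r pairing_linr (hom' false) // (hom' true) // mulr0 addr0.
Qed.

(* If r is the residue of x and q separates r from the annihilator, then adding
   the pair (r, q'), where q' vanishes on the span of the family, makes the
   family adapted to x as well. *)
Lemma adapted_family_exists (X : seq g) :
  (forall x, x \in X -> exists a, x \in comp g a) ->
  exists2 E, dual_family E & adapted E X.
Proof.
elim: X => [|x X IHX] Xhom; first by exists [::].
have [|E dE aE] := IHX; first by move=> y yX; apply: Xhom; rewrite inE yX orbT.
have [a xa] : exists a, x \in comp g a by apply: Xhom; rewrite mem_head.
pose r := x - \sum_(e <- E) pairing e.2 x *: e.1.
have ra : r \in comp g a.
  rewrite rpredB // big_seq rpred_sum // => e /dE [b [e1 e2]].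
  have [eba|ba] := eqVneq b a; first by rewrite rpredZ // -eba.
  by rewrite (pairing_parity e2 xa ba) scale0r rpred0.
have [rA|rnA] := boolP (r \in annihilator_space phi).
  exists E => // y; rewrite inE => /orP[/eqP->|]; last exact: aE.
  by rewrite -opprB rpredN.
have [q qa qr] : exists2 q, q \in comp p a & pairing q r != 0.
  apply: contrapT => nq; case/negP: rnA; apply: (pairing0_annihilator ra) => q qa.
  by apply/eqP/negPn/negP => qr; apply: nq; exists q.
pose q' := q - \sum_(e <- E) pairing q e.1 *: e.2.
have q'a : q' \in comp p a.
  rewrite rpredB // big_seq rpred_sum // => e /dE [b [e1 e2]].
  have [eba|ba] := eqVneq b a; first by rewrite rpredZ // -eba.
  by rewrite (pairing_parity qa e1) ?scale0r ?rpred0 // eq_sym.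
have q'E y : pairing q' y = pairing q (y - \sum_(e <- E) pairing e.2 y *: e.1).
  rewrite addrC -scaleN1r pairing_linr pairing_sumr.
  rewrite /q' addrC -scaleN1r pairing_linl pairing_suml.
  by congr (_ * _ + _); apply: eq_bigr => e _; rewrite mulrC.
(* The inverse makes the new pair contribute exactly [r] at [x]. *)
exists (((pairing q r)^-1 *: r, q') :: E).
  by move=> e; rewrite inE => /orP[/eqP->|/dE//]; exists a; rewrite rpredZ.
move=> y; rewrite big_cons -[pairing _ y]/(pairing q' y) -[(_, _).1]/(_ *: r).
rewrite q'E scalerA => yX.
move: yX; rewrite inE => /orP[/eqP->|yX].
  by rewrite -/r divff // scale1r /r subrK subrr rpred0.
have yA := aE y yX.
rewrite (annihilator_pairing q) ?mul0r ?scale0r ?add0r //.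
by rewrite -opprB rpredN.
Qed.

(** * Filtration by word length *)

Variables (V : supermodule g) (v : V).
Hypothesis v_whittaker : whittaker_vector phi v.
Hypothesis v_eigen :
  forall y, y \in annihilator_space phi -> exists c : K, act y v = c *: v.

Definition contraction (q : p) (u : V) : V := act (val q) u - (phi q : K) *: u.

Lemma contraction_linr q : linear (contraction q).
Proof.
move=> c u w; rewrite /contraction act_linr scalerDr opprD addrACA scalerBr.
by rewrite !scalerA (mulrC c).
Qed.

Lemma contraction_linl u : linear (contraction^~ u).
Proof.
move=> c q r; rewrite /contraction linearP /= act_linl scalerDl opprD addrACA.
by rewrite scalerBr scalerA.
Qed.

(** Moving [q] past [x] produces [q, x], again in the ideal; it splits into the scalar [pairing q x]
    and a contraction of its own. *)
Lemma contraction_act a b q x u : q \in comp p a -> x \in comp g b ->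
  contraction q (act x u) = ssign a b *: act x (contraction q u)
    + pairing q x *: u + contraction (ideal_rbracket q x) u.
Proof.
move=> qa xb; rewrite /contraction -addrA [_ *: u + _]addrC subrK.
have -> : val (ideal_rbracket q x) = br (val q) x by [].
rewrite (act_br u (qa : val q \in comp g a) xb).
rewrite (linearfD (act_linr x)) (linearfN (act_linr x)) (linearfZ (act_linr x)).
rewrite scalerBr [RHS]addrC -[_ - _ + _]addrA [- _ + _]addrA addNr add0r.
rewrite scalerA; congr (_ - _ *: _).
(* An odd [q] has [phi q = 0], so the sign on the scalar term is harmless. *)
case: a qa => [qa|_]; first by rewrite (chi_odd phi qa) mulr0.
by rewrite mul1r.
Qed.

(** Words of length less than [n] applied to [v]: [level 0] is zero and [level 1] is the line of
    [v]. *)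
Fixpoint level (n : nat) : subspace V :=
  if n is n.+1 then span (fun w => [\/ w = v, w \in level n |
    exists a x u, [/\ x \in comp g a, u \in level n & w = act x u]])
  else span (fun _ => False).

Lemma level0 u : u \in level 0 -> u = 0.
Proof.
by move: u; apply: span_ind => // c u1 u2 -> ->; rewrite scaler0 addr0.
Qed.

Lemma levelS n u : u \in level n -> u \in level n.+1.
Proof. by move=> un; apply: span_gen; constructor 2. Qed.

Lemma level_pred n u : u \in level n.-1 -> u \in level n.
Proof. by case: n => // n; exact: levelS. Qed.

Lemma level_gen n : v \in level n.+1.
Proof. by apply: span_gen; constructor 1. Qed.

Lemma level1 u : u \in level 1 -> exists c : K, u = c *: v.
Proof.
move: u; apply: span_ind => [|c _ _ [a ->] [b ->]|w [->|/level0->|[a [x [w' [_ /level0-> ->]]]]]].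
- by exists 0; rewrite scale0r.
- by exists (c * a + b); rewrite scalerA -scalerDl.
- by exists 1; rewrite scale1r.
- by exists 0; rewrite scale0r.
- by exists 0; rewrite scale0r (linearf0 (act_linr _)).
Qed.

Lemma level_act n x u : u \in level n -> act x u \in level n.+1.
Proof.
move=> un; have [x0 [x1 [x0g x1g ->]]] := comp_cover x.
rewrite (linearfD (act_linl u)) rpredD //; apply: span_gen; constructor 3.
  by exists false, x0, u.
by exists true, x1, u.
Qed.

(** The annihilator scales [v], and moving it past a letter costs a bracket, which merely replaces
    that letter. *)
Lemma level_annihilator n y u :
  y \in annihilator_space phi -> u \in level n -> act y u \in level n.
Proof.
elim: n u y => [|n IHn] u y yA.
  by move/level0->; rewrite (linearf0 (act_linr _)) rpred0.
move: u; apply: span_ind => [|c u w IHu IHw|w [->|wn|[a [x [u [xa un ->]]]]]].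
- by rewrite (linearf0 (act_linr _)) rpred0.
- by rewrite act_linr; exact: subspaceZD.
- by have [c ->] := v_eigen yA; rewrite rpredZ // level_gen.
- exact/levelS/IHn.
have hom b z : z \in annihilator_space phi -> z \in comp g b ->
    act z (act x u) \in level n.+1.
  move=> zA zb; have := act_br u zb xa.
  move/(congr1 (fun t => t + ssign b a *: act x (act z u))); rewrite subrK => <-.
  by rewrite rpredD ?rpredZ ?level_act // IHn.
have [y0 [y1 [y0A y1A y0g y1g ->]]] := annihilator_graded yA.
by rewrite (linearfD (act_linl _)) rpredD //; [exact: hom y0g | exact: hom y1g].
Qed.

Lemma level_contraction n q u : u \in level n -> contraction q u \in level n.-1.
Proof.
elim: n u q => [|n IHn] u q.
  by move/level0->; rewrite (linearf0 (contraction_linr _)) rpred0.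
move: u; apply: span_ind => [|c u w IHu IHw|w [->|wn|[b [x [u [xb un ->]]]]]].
- by rewrite (linearf0 (contraction_linr _)) rpred0.
- by rewrite contraction_linr; exact: subspaceZD.
- by rewrite /contraction v_whittaker subrr rpred0.
- exact/(@level_pred n)/IHn.
elim/comp_ind: q => [q r IHq IHr|a q qa].
  by rewrite (linearfD (contraction_linl _)) rpredD.
rewrite (contraction_act _ qa xb); apply: rpredD; last first.
  exact: (@level_pred n _ (IHn u _ un)).
apply: rpredD; last exact: rpredZ.
apply: rpredZ.
(* At [n = 0] the predecessor is truncated, but there [u] is zero. *)
case: n IHn un => [|n] IHn un; last exact: (level_act x (IHn u q un)).
rewrite (level0 un) (linearf0 (contraction_linr _)) (linearf0 (act_linr _)).
exact: rpred0.
Qed.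

(** * The Euler operator *)

Definition euler (E : seq (g * p)) (u : V) : V :=
  \sum_(e <- E) act e.1 (contraction e.2 u).

Lemma euler_linear E : linear (euler E).
Proof.
move=> c u w; rewrite /euler scaler_sumr -big_split; apply: eq_bigr => e _.
by rewrite contraction_linr act_linr.
Qed.

Lemma level_act_contraction n x q u :
  u \in level n -> act x (contraction q u) \in level n.
Proof.
case: n => [|n] un.
  rewrite (level0 un) (linearf0 (contraction_linr _)) (linearf0 (act_linr _)).
  exact: rpred0.
exact/level_act/(level_contraction q un).
Qed.

Lemma euler_level E n u : u \in level n -> euler E u \in level n.
Proof. by move=> un; rewrite rpred_sum // => e _; exact: level_act_contraction. Qed.

(** The pairing terms sum to [act x u] up to the annihilator, which preserves levels. Both entries
    of a pair have the same parity, so the signs combine the remaining terms into brackets of level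
    [n]. *)
Lemma euler_act E n b x u : dual_family E -> adapted E [:: x] ->
  x \in comp g b -> u \in level n ->
  euler E (act x u) - (act x (euler E u) + act x u) \in level n.
Proof.
move=> dE aE xb un; pose y := \sum_(e <- E) pairing e.2 x *: e.1 - x.
have yu : act y u \in level n.
  by apply: level_annihilator un; apply: aE; rewrite mem_head.
have xuE : act x u = \sum_(e <- E) pairing e.2 x *: act e.1 u - act y u.
  apply/eqP; rewrite eq_sym subr_eq; apply/eqP.
  rewrite -(linearfD (act_linl u)) addrC subrK.
  elim: (E) => [|e F IHF]; first by rewrite !big_nil (linearf0 (act_linl u)).
  by rewrite !big_cons act_linl IHF.
rewrite [X in _ - (_ + X)]xuE opprD opprB [act y u - _]addrC !addrA.
apply: rpredD => //; rewrite -(linearfN (act_linr x)) /euler -sumrN.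
have -> : act x (\sum_(e <- E) - act e.1 (contraction e.2 u))
    = \sum_(e <- E) - act x (act e.1 (contraction e.2 u)).
  elim: (E) => [|e F IHF]; first by rewrite !big_nil (linearf0 (act_linr x)).
  by rewrite !big_cons (linearfD (act_linr x)) (linearfN (act_linr x)) IHF.
rewrite -sumrN -!big_split big_seq; apply: rpred_sum => e /dE [a [e1 e2]].
rewrite -[X in X \in _]/(_ - _ - _) (contraction_act _ e2 xb).
have := level_act_contraction e.1 (ideal_rbracket e.2 x) un.
move: (contraction (ideal_rbracket e.2 x) u) => t tn.
have := level_act_contraction (br e.1 x) e.2 un.
have := act_br (contraction e.2 u) e1 xb.
move: (contraction e.2 u) => w -> wn.
rewrite !(linearfD (act_linr e.1)) !(linearfZ (act_linr e.1)).
rewrite [X in X \in _](ACl (1*4*3*(2*5))%AC) [X in X \in _]/= subrr addr0.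
apply: rpredD => //.
rewrite (_ : _ - _ = ssign a b *: (act e.1 (act x w) - ssign a b *: act x (act e.1 w))).
  exact: rpredZ.
by rewrite scalerBr scalerA -signr_addb addbb scale1r.
Qed.

(* Modulo lower levels, the Euler operator multiplies a word by its length. *)
Lemma euler_top n u : u \in level n.+1 -> exists2 X : seq g,
  (forall x, x \in X -> exists a, x \in comp g a) &
  forall E, dual_family E -> adapted E X -> euler E u - n%:R *: u \in level n.
Proof.
elim: n u => [|n IHn].
  move=> u /level1 [c ->]; exists [::] => // E _ _.
  rewrite scale0r subr0 (linearfZ (euler_linear E)) /euler big1 ?scaler0 ?rpred0 //.
  by move=> e _; rewrite /contraction v_whittaker subrr (linearf0 (act_linr _)).
apply: span_ind => [|c u w [X hX eX] [Y hY eY]|w [->|wn|[a [x [u [xa un ->]]]]]].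
- exists [::] => // E _ _.
  by rewrite (linearf0 (euler_linear E)) scaler0 subr0 rpred0.
- exists (X ++ Y) => [x|E dE aE].
    by rewrite mem_cat => /orP[/hX|/hY].
  have /eX uX : adapted E X by move=> x xX; apply: aE; rewrite mem_cat xX.
  have /eY wY : adapted E Y by move=> x xY; apply: aE; rewrite mem_cat xY orbT.
  rewrite euler_linear scalerDr opprD addrACA scalerA mulrC -scalerA -scalerBr.
  by apply: subspaceZD; [exact: uX | exact: wY].
- by exists [::] => // E _ _; rewrite rpredB ?rpredZ ?euler_level ?level_gen.
- by exists [::] => // E _ _; rewrite rpredB ?rpredZ ?euler_level.
have [X hX eX] := IHn u un.
exists (x :: X) => [y|E dE aE].
  by rewrite inE => /orP[/eqP->|/hX//]; exists a.
have /eX uX : adapted E X by move=> y yX; apply: aE; rewrite inE yX orbT.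
have aX : adapted E [:: x].
  by move=> y; rewrite inE => /eqP->; apply: aE; rewrite mem_head.
rewrite -(subrK (act x (euler E u) + act x u) (euler E (act x u))) -addrA.
apply: rpredD; first exact: (@euler_act E n.+1 a x u).
rewrite -nat1r scalerDl scale1r opprD addrA addrK.
rewrite -(linearfZ (act_linr x)) -(linearfN (act_linr x)) -(linearfD (act_linr x)).
exact/level_act/uX.
Qed.

(** The hypothesis puts [euler E u] in [level n.+1], and modulo that level it equals [n.+1] times
    [u]; this factor is invertible in characteristic 0. *)
Lemma level_lower n u : u \in level n.+2 ->
  (forall q, contraction q u \in level n) -> u \in level n.+1.
Proof.
move=> un cu; have [X hX eX] := euler_top un.
have [E dE aE] := adapted_family_exists hX.
have := eX E dE aE; rewrite rpredBl; last first.
  by rewrite rpred_sum // => e _; exact: level_act.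
by rewrite rpredZeq pnatr_eq0.
Qed.

Lemma whittaker_vector_level n u :
  whittaker_vector phi u -> u \in level n -> exists c : K, u = c *: v.
Proof.
move=> wu; case: n => [/level0->|n]; first by exists 0; rewrite scale0r.
elim: n => [|n IHn] un; first exact: level1.
by apply/IHn/level_lower => // q; rewrite /contraction wu subrr rpred0.
Qed.

(** Contractions preserve [N] and lower the level. Either one of them leaves [level n], hence is
    nonzero and replaces [u], or [level_lower] applies to [u] itself. *)
Lemma stable_subspace_gen n (N : subspace V) u :
  (forall x w, w \in N -> act x w \in N) ->
  u \in N -> u != 0 -> u \in level n -> v \in N.
Proof.
move=> stN; case: n => [_ nz /level0 z|n]; first by rewrite z eqxx in nz.
elim: n u => [|n IHn] u uN nz un.
  have [c e] := level1 un; move: uN nz; rewrite e => uN.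
  by rewrite scaler_eq0 negb_or => /andP[c0 _]; rewrite rpredZeq (negPf c0) in uN.
have [[q /negP qu]|nq] := pselect (exists q, ~ contraction q u \in level n).
  apply: (IHn (contraction q u)).
  - by rewrite rpredB ?rpredZ // stN.
  - by apply: contraNneq qu => ->; rewrite rpred0.
  - exact: (level_contraction q un).
apply: (IHn u) => //; apply: level_lower => // q.
by apply: contrapT => qu; apply: nq; exists q.
Qed.
End Contraction.

(** * Modules induced from a character *)

Section InducedCharacter.
Variables (K : numFieldType) (g : lieSuperalgebra K) (h : gradedSubalgebra g).
Variable chi : lsaHom h (scalar_lsa K).
Local Notation M := (one_dim chi).

Definition cyclic_vector : Ind M := @tensor K g h M 1 (1 : K^o).

Let eact_iota := env_act_iota (@act_linr K h M) (@act_linl K h M) (@act_br K h M).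
Let eact1 := env_act1 (@act_linr K h M) (@act_linl K h M) (@act_br K h M).
Let eactM := env_actM (@act_linr K h M) (@act_linl K h M) (@act_br K h M).
Let eact_linl := env_act_linl (@act_linr K h M) (@act_linl K h M) (@act_br K h M).

Lemma tensor_one (u : env g) (m : M) : tensor u m = (m : K) *: @tensor K g h M u (1 : K^o).
Proof. by rewrite -tensorZr; congr tensor; exact/esym/mulr1. Qed.

Lemma act_cyclic_vector (y : h) :
  act (val y) cyclic_vector = (chi y : K) *: cyclic_vector.
Proof.
rewrite [LHS]ind_act_tensor mulr1 -[iota (val y)]mul1r -env_incl_iota tensor_bal.
by rewrite eact_iota tensor_one; congr (_ *: _); exact: mulr1.
Qed.

(** * Universal property of the induced module *)

Section Lift.
Variables (W : lmodType K) (T : g -> W -> W) (w : W).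
Hypothesis T_linr : forall x, linear (T x).
Hypothesis T_linl : forall m, linear (T^~ m).
Hypothesis T_br : forall a b x y m, x \in comp g a -> y \in comp g b ->
  T (br x y) m = T x (T y m) - ssign a b *: T y (T x m).
Hypothesis T_eigen : forall y : h, T (val y) w = (chi y : K) *: w.

Let F (u : env g) (m : M) : W := (m : K) *: env_act T u w.
Let F_linl m : linear (F^~ m).
Proof.
move=> c u v; rewrite /F (env_act_linl T_linr T_linl T_br) scalerDr !scalerA.
by rewrite (mulrC c).
Qed.
Let F_Dr u m n : F u (m + n) = F u m + F u n.
Proof. exact: scalerDl. Qed.

(** Gives the balancing relation: the enveloping algebra of [h] acts on the line of [w] through
    [chi]. *)
Lemma env_act_incl a (m : M) : (m : K) *: env_act T (env_incl a) w
  = (env_act (@act K h M) a m : K) *: w.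
Proof.
elim/env_ind: a => [c u v IHu IHv||y a IHa].
- rewrite env_incl_linear (env_act_linl T_linr T_linl T_br) scalerDr scalerA.
  rewrite mulrC -scalerA IHu IHv eact_linl.
  by rewrite [RHS](scalerDl _ (c *: _ : K^o)) scalerA.
- by rewrite env_incl1 (env_act1 T_linr T_linl T_br) eact1.
- rewrite env_inclM env_incl_iota (env_actM T_linr T_linl T_br).
  rewrite (env_act_iota T_linr T_linl T_br) -(linearfZ (T_linr _)) IHa.
  by rewrite (linearfZ (T_linr _)) T_eigen eactM eact_iota scalerA mulrC.
Qed.

Let F_bal u a m : F (u * env_incl a) m = F u (env_act (@act K h M) a m).
Proof.
rewrite /F (env_actM T_linr T_linl T_br).
rewrite -(linearfZ (env_act_linr T_linr _)) env_act_incl.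
by rewrite (linearfZ (env_act_linr T_linr _)).
Qed.

Definition ind_map : Ind M -> W := ind_lift F.

Lemma ind_map_linear : linear ind_map.
Proof. exact: ind_lift_linear F_linl F_Dr F_bal. Qed.

Lemma ind_map_tensor u (m : M) : ind_map (tensor u m) = (m : K) *: env_act T u w.
Proof. exact: ind_lift_tensor F_linl F_Dr F_bal u m. Qed.

Lemma ind_map_cyclic : ind_map cyclic_vector = w.
Proof. by rewrite ind_map_tensor (env_act1 T_linr T_linl T_br) scale1r. Qed.

Lemma ind_map_act x t : ind_map (act x t) = T x (ind_map t).
Proof.
elim/ind_ind: t => [|c s t IHs IHt|u m].
- by rewrite (linearf0 (act_linr _)) (linearf0 ind_map_linear) (linearf0 (T_linr x)).
- by rewrite act_linr !ind_map_linear T_linr IHs IHt.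
- rewrite [act x _]ind_act_tensor !ind_map_tensor (env_actM T_linr T_linl T_br).
  by rewrite (env_act_iota T_linr T_linl T_br) (linearfZ (T_linr x)).
Qed.
End Lift.

(** The universal map sends [cyclic_vector] to the nonzero eigenvector of the model. *)
Lemma cyclic_vector_neq0 : cyclic_vector != 0.
Proof.
have [W [T [w [Tr Tl Tbr w0 Tw]]]] := character_model chi.
apply: contraNneq w0 => c0; rewrite -(ind_map_cyclic Tr Tl Tbr Tw) c0.
by rewrite (linearf0 (ind_map_linear Tr Tl Tbr Tw)).
Qed.

Lemma cyclic_vector_even : cyclic_vector \in comp (Ind M) false.
Proof.
apply: span_gen; exists false, false, 1, (1 : K^o); split=> //.
- exact/span_gen/EnvOne.
- exact: even_comp0.
Qed.

(** An odd [w] is allowed; it is the source of the parity shift in the classification. *)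
Lemma ind_map_comp (V : supermodule g) (w : V) a b t : w \in comp V b ->
  (forall y : h, act (val y) w = (chi y : K) *: w) ->
  t \in comp (Ind M) a -> ind_map (@act K g V) w t \in comp V (a (+) b).
Proof.
move=> wb we; have lin := ind_map_linear (@act_linr K g V) (@act_linl K g V) (@act_br K g V) we.
move: t; apply: span_ind => [|c s t IHs IHt|_ [c [m [u [x [uc xm -> ->]]]]]].
- by rewrite (linearf0 lin) rpred0.
- by rewrite lin; exact: subspaceZD.
rewrite (ind_map_tensor (@act_linr K g V) (@act_linl K g V) (@act_br K g V) we).
have uw : env_act (@act K g V) u w \in comp V (c (+) b).
  have elin := env_act_linl (@act_linr K g V) (@act_linl K g V) (@act_br K g V) w.
  move: u uc; apply: span_ind => [|r u v IHu IHv|u].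
  - by rewrite (linearf0 elin) rpred0.
  - by rewrite elin; exact: subspaceZD.
  elim=> [|c1 c2 y {}u yc _ IHu].
    by rewrite (env_act1 (@act_linr K g V) (@act_linl K g V) (@act_br K g V)).
  rewrite (env_actM (@act_linr K g V) (@act_linl K g V) (@act_br K g V)).
  rewrite (env_act_iota (@act_linr K g V) (@act_linl K g V) (@act_br K g V)).
  by rewrite -addbA; exact: act_even.
case: m xm => xm; last by rewrite addbF rpredZ.
move: xm; rewrite [_ \in _]even_comp1 => /eqP ->.
by rewrite scale0r rpred0.
Qed.
End InducedCharacter.

(** * Bland modules *)

Section Bland.
Variables (K : numFieldType) (g : lieSuperalgebra K) (p : gradedIdeal g).
Variable phi : lsaHom p (scalar_lsa K).
Local Notation h := (whittaker_annihilator phi).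

Lemma level_mono (V : supermodule g) (w : V) m n u :
  (m <= n)%N -> u \in level w m -> u \in level w n.
Proof.
elim: n => [|n IHn]; first by rewrite leqn0 => /eqP->.
by rewrite leq_eqVlt => /orP[/eqP->//|/IHn mn /mn]; exact: levelS.
Qed.

Lemma level_stable (V : supermodule g) (w : V) (N : subspace V) n u :
  (forall x t, t \in N -> act x t \in N) -> w \in N -> u \in level w n -> u \in N.
Proof.
move=> stN wN; elim: n u => [|n IHn] u; first by move/level0->; exact: rpred0.
move: u; apply: span_ind => [|c s t|t]; first exact: rpred0.
  exact: subspaceZD.
by case=> [->//|/IHn//|[a [x [u [_ /IHn uN ->]]]]]; exact: stN.
Qed.

(** * Modules induced from extensions are bland *)

Section Extension.
Variable phi' : extension phi.
Local Notation v := (cyclic_vector phi').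

Lemma cyclic_vector_whittaker : @whittaker_vector K g p phi (Vind phi') v.
Proof.
move=> q; rewrite -(extension_extends phi' q).
exact: (act_cyclic_vector phi' (annihilator_incl phi q)).
Qed.

Lemma cyclic_vector_eigen (y : g) : y \in annihilator_space phi ->
  exists c : K, @act K g (Vind phi') y v = c *: v.
Proof. by move=> yA; eexists; exact: (act_cyclic_vector phi' (Sub y yA)). Qed.

Lemma Vind_level (t : Vind phi') : exists n, t \in level v n.
Proof.
elim/ind_ind: t => [|c s t [m sm] [n tn]|u m].
- by exists 0%N; exact: rpred0.
- exists (maxn m n); apply: subspaceZD.
    by apply: level_mono sm; exact: leq_maxl.
  by apply: level_mono tn; exact: leq_maxr.
rewrite tensor_one.
suff [n un] : exists n, @tensor K g h (one_dim phi') u (1 : K^o) \in level v n.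
  by exists n; exact: rpredZ.
elim/env_ind: u => [c u w [k uk] [n wn]||x u [n un]].
- rewrite tensor_linl; exists (maxn k n); apply: subspaceZD.
    by apply: level_mono uk; exact: leq_maxl.
  by apply: level_mono wn; exact: leq_maxr.
- by exists 1%N; exact: (@level_gen K g (Vind phi') v 0).
- exists n.+1; rewrite -[tensor _ _]ind_act_tensor.
  exact: (level_act x un).
Qed.

Lemma stable_cyclic (N : subspace (Vind phi')) (u : Vind phi') :
  (forall x t, t \in N -> act x t \in N) -> u \in N -> u != 0 -> v \in N.
Proof.
move=> stN uN u0; have [n un] := Vind_level u.
exact: (stable_subspace_gen cyclic_vector_whittaker cyclic_vector_eigen stN uN u0 un).
Qed.

Lemma stable_full (N : subspace (Vind phi')) :
  (forall x t, t \in N -> act x t \in N) -> v \in N -> forall t, t \in N.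
Proof. by move=> stN vN t; have [n] := Vind_level t; exact: level_stable. Qed.

Lemma Vind_whittaker (u : Vind phi') : whittaker_vector phi u ->
  exists c : K, u = c *: v.
Proof.
move=> wu; have [n un] := Vind_level u.
exact: (whittaker_vector_level cyclic_vector_whittaker cyclic_vector_eigen wu un).
Qed.

Lemma bland_Vind : bland phi (Vind phi').
Proof.
split.
- exists false, v; split; first exact: cyclic_vector_even.
    exact: cyclic_vector_whittaker.
  by move=> N [_ stN]; exact: stable_full.
- split; first by exists v; exact: cyclic_vector_neq0.
  move=> N [_ stN]; have [[u [uN u0]]|nN] := pselect (exists u, u \in N /\ u != 0).
    by right; apply: stable_full => //; exact: stable_cyclic uN u0.
  left=> u uN; apply: contrapT => /eqP u0; apply: nN; by exists u.
- exists v; split; first exact: cyclic_vector_neq0.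
    exact: cyclic_vector_whittaker.
  exact: Vind_whittaker.
Qed.
End Extension.

(** The image of the first cyclic vector is a nonzero multiple of the second, so the eigenvalues
    agree. Maps of any parity are allowed in order to cover the parity shift. *)
Lemma Vind_inj (phi1 phi2 : extension phi) (f : {linear Vind phi1 -> Vind phi2}) :
  injective f -> (forall (x : g) (u : Vind phi1), f (act x u) = act x (f u)) ->
  phi1 =1 phi2.
Proof.
move=> f_inj f_act y.
have [|c fv] := @Vind_whittaker phi2 (f (cyclic_vector phi1)).
  by move=> q; rewrite -f_act cyclic_vector_whittaker linearZ.
have fv0 : f (cyclic_vector phi1) != 0.
  by rewrite -(linear0 f) (inj_eq f_inj) cyclic_vector_neq0.
have : (phi1 y : K) *: f (cyclic_vector phi1) = (phi2 y : K) *: f (cyclic_vector phi1).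
  have <- : f ((phi1 y : K) *: cyclic_vector phi1)
      = (phi1 y : K) *: f (cyclic_vector phi1) by rewrite linearZ.
  rewrite -(act_cyclic_vector phi1 y) f_act fv (linearfZ (act_linr _)).
  by rewrite (act_cyclic_vector phi2 y) !scalerA mulrC.
move/eqP; rewrite -subr_eq0 -scalerBl scaler_eq0 (negPf fv0) orbF subr_eq0.
by move/eqP.
Qed.

Lemma iso_upto_parity_Vind_inj (phi1 phi2 : extension phi) :
  iso_upto_parity (Vind phi1) (Vind phi2) -> phi1 =1 phi2.
Proof.
by case=> -[f [/bij_inj f_inj _ f_act]]; exact: (@Vind_inj phi1 phi2 f).
Qed.

(** * Recovering the extension from a bland module *)

Section Classification.
Variable V : supermodule g.

Lemma whittaker_contraction (u : V) :
  whittaker_vector phi u <-> forall q, contraction phi q u = 0.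
Proof.
split=> [wu q|cu q]; first by rewrite /contraction wu subrr.
by apply/eqP; rewrite -subr_eq0; apply/eqP/cu.
Qed.

(** In [contraction_act] the pairing term vanishes on the annihilator, and the other two terms come
    from contractions of [u]. *)
Lemma annihilator_whittaker (y : h) (u : V) :
  whittaker_vector phi u -> whittaker_vector phi (act (val y) u).
Proof.
move=> /whittaker_contraction cu; apply/whittaker_contraction.
have [y0 [y1 [y0A y1A y0g y1g ->]]] := annihilator_graded (valP y).
have hom a z : z \in comp g a -> z \in annihilator_space phi ->
    forall q, contraction phi q (act z u) = 0.
  move=> za zA q; elim/comp_ind: q => [q r IHq IHr|b q qb].
    by rewrite (linearfD (contraction_linl phi _)) IHq IHr addr0.
  rewrite (contraction_act phi u qb za) !cu annihilator_pairing //.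
  by rewrite (linearf0 (act_linr _)) scaler0 scale0r !addr0.
move=> q; rewrite (linearfD (act_linl u)) (linearfD (contraction_linr _ _)).
by rewrite (hom false) // (hom true) // addr0.
Qed.

Hypothesis V_bland : bland phi V.

Lemma bland_generator : exists a (w : V), [/\ w \in comp V a, w != 0,
  whittaker_vector phi w, generated_by w
  & forall u : V, whittaker_vector phi u -> exists c : K, u = c *: w].
Proof.
have [[a [w [wa ww wg]]] [[v v0] _] [u [u0 uw uall]]] := V_bland.
have w0 : w != 0.
  (* A zero generator would generate only the zero submodule. *)
  pose N : subspace V := span (fun _ => False).
  have NP t : t \in N -> t = 0.
    by move: t; apply: span_ind => // c s t -> ->; rewrite scaler0 addr0.
  apply: contraNneq v0 => w0; apply/eqP/NP/wg; last by rewrite w0 rpred0.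
  split=> [t /NP->|x t /NP->]; last by rewrite (linearf0 (act_linr _)) rpred0.
  by exists 0, 0; rewrite !rpred0 addr0.
exists a, w; split=> // t /uall [c ->].
have [r er] := uall _ ww; exists (c / r).
rewrite er scalerA divfK //; apply: contraNneq w0 => r0.
by rewrite er r0 scale0r.
Qed.

(** The eigenvalues on the line of quasi-Whittaker vectors form a character of the annihilator; it
    vanishes on odd elements because these change the parity of [w]. *)
Lemma bland_extension : exists (phi' : extension phi) a (w : V),
  [/\ w \in comp V a, w != 0, generated_by w
    & forall y : h, act (val y) w = (phi' y : K) *: w].
Proof.
have [a [w [wa w0 ww wg wall]]] := bland_generator.
have ev (y : h) : exists c : K, act (val y) w = c *: w.
  exact/wall/annihilator_whittaker.
pose f (y : h) : K^o := projT1 (cid (ev y)).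
have fE y : act (val y) w = (f y : K) *: w by exact: projT2 (cid (ev y)).
have inj (c d : K) : c *: w = d *: w -> c = d.
  move/eqP; rewrite -subr_eq0 -scalerBl scaler_eq0 (negPf w0) orbF subr_eq0.
  by move/eqP.
have f_lin : linear f.
  move=> c x y; apply: inj; rewrite -fE -[val _]/(c *: val x + val y).
  by rewrite act_linl !fE scalerA -scalerDl.
have f_odd x : x \in comp h true -> f x = 0.
  move=> x1; have xw := act_even (x1 : val x \in comp g true) wa.
  rewrite fE in xw; apply: inj; rewrite scale0r.
  have xw' : f x *: w \in comp V a by rewrite rpredZ.
  by case: (a) xw xw' => xw xw'; apply: comp_direct.
pose fl : {linear h -> scalar_lsa K} := linear_pack f_lin.
have f_even b x : x \in comp h b -> fl x \in comp (scalar_lsa K) b.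
  case: b => xb; last exact: even_comp0.
  by rewrite [_ \in _]even_comp1; apply/eqP/f_odd.
have f_br x y : fl (br x y) = br (fl x) (fl y).
  elim/comp_ind: x => [x x' IHx IHx'|b x xb].
    by rewrite (linearfD (br_linl _)) linearD IHx IHx' addr0.
  elim/comp_ind: y => [y y' IHy IHy'|c y yc].
    by rewrite (linearfD (br_linr _)) linearD IHy IHy' addr0.
  apply: inj; rewrite scale0r -[fl _]/(f _) -fE.
  rewrite -[val _]/(br (val x) (val y)).
  rewrite (act_br w (xb : val x \in comp g b) (yc : val y \in comp g c)).
  rewrite !fE !(linearfZ (act_linr _)) !fE.
  case: b xb => [/f_odd->|_]; first by rewrite !(scale0r, scaler0) subr0.
  by rewrite scale1r !scalerA mulrC subrr.
pose phi' := LsaHom f_even f_br.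
have ext : extends phi'.
  by move=> q; apply: inj; rewrite -[phi' _]/(f _) -fE; exact: ww.
by exists (Extension ext), a, w; split=> //; exact: fE.
Qed.

Lemma bland_classification :
  exists phi' : extension phi, iso_upto_parity V (Vind phi').
Proof.
have [phi' [a [w [wa w0 wg we]]]] := bland_extension; exists phi'.
pose f := ind_map (chi := phi') (@act K g V) w.
have f_lin : linear f.
  exact: (ind_map_linear (@act_linr K g V) (@act_linl K g V) (@act_br K g V) we).
have f_act x t : f (act x t) = act x (f t).
  exact: (ind_map_act (@act_linr K g V) (@act_linl K g V) (@act_br K g V) we).
have f_cyc : f (cyclic_vector phi') = w.
  exact: (ind_map_cyclic (@act_linr K g V) (@act_linl K g V) (@act_br K g V) we).
have f_comp b t : t \in comp (Vind phi') b -> f t \in comp V (b (+) a).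
  exact: ind_map_comp wa we.
have ker0 t : f t = 0 -> t = 0.
  move=> ft; apply: contrapT => /eqP t0.
  have N0 : f 0 = 0 by exact: linearf0 f_lin.
  have NZ c s s' : f s = 0 -> f s' = 0 -> f (c *: s + s') = 0.
    by move=> s0 s'0; rewrite f_lin s0 s'0 scaler0 addr0.
  (* The kernel is stable, so if nonzero it would contain the cyclic vector, whose image is [w]. *)
  have /(subspace_ofP N0 NZ) : cyclic_vector phi' \in subspace_of N0 NZ.
    apply: stable_cyclic t0; last exact/subspace_ofP.
    move=> x s /(subspace_ofP N0 NZ) s0; apply/(subspace_ofP N0 NZ).
    by rewrite f_act s0 (linearf0 (act_linr _)).
  by rewrite f_cyc => /eqP; rewrite (negPf w0).
have f_inj : injective f.
  move=> s t st; apply/eqP; rewrite -subr_eq0; apply/eqP/ker0.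
  by rewrite (linearfD f_lin) (linearfN f_lin) st subrr.
have f_surj u : exists t, f t = u.
  pose Q (u : V) := exists t, f t = u.
  have Q0 : Q 0 by exists 0; exact: linearf0 f_lin.
  have QZ c s s' : Q s -> Q s' -> Q (c *: s + s').
    by move=> [t <-] [t' <-]; exists (c *: t + t'); exact: f_lin.
  apply/(subspace_ofP Q0 QZ)/wg; last first.
    by apply/(subspace_ofP Q0 QZ); exists (cyclic_vector phi').
  split=> [_ /(subspace_ofP Q0 QZ) [t <-]|x _ /(subspace_ofP Q0 QZ) [t <-]]; last first.
    by apply/(subspace_ofP Q0 QZ); exists (act x t); exact: f_act.
  have [t0 [t1 [/f_comp t0c /f_comp t1c ->]]] := comp_cover t.
  have Qf s : f s \in subspace_of Q0 QZ by apply/(subspace_ofP Q0 QZ); exists s.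
  rewrite (linearfD f_lin).
  case: (a) t0c t1c => t0c t1c; first by exists (f t1), (f t0); rewrite addrC.
  by exists (f t0), (f t1).
pose f' (u : V) : Vind phi' := projT1 (cid (f_surj u)).
have f'K : cancel f' f by move=> u; exact: projT2 (cid (f_surj u)).
have fK : cancel f f' by move=> t; apply: f_inj; rewrite f'K.
have f'_lin : linear f' by move=> c u u'; apply: f_inj; rewrite f_lin !f'K.
have f'_act x u : f' (act x u) = act x (f' u).
  by apply: f_inj; rewrite f_act !f'K.
have f'_comp b u : u \in comp V b -> f' u \in comp (Vind phi') (b (+) a).
  move=> ub; have [t0 [t1 [t0c t1c e]]] := comp_cover (f' u).
  have := f'K u; rewrite e (linearfD f_lin) => eu.
  have f0 := f_comp _ _ t0c; have f1 := f_comp _ _ t1c.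
  (* The part of the preimage with the wrong parity has its image in both components, so it is
     zero. *)
  have wrong r s : f r + f s = u -> f r \in comp V b -> f s \in comp V (~~ b) -> s = 0.
    move=> ers fr fs; have fs' : f s \in comp V b.
      have -> : f s = u - f r by rewrite -ers addrC addKr.
      exact: rpredB.
    by apply: ker0; case: (b) fs fs' => s0 s1; exact: comp_direct.
  move: f0 f1 ub wrong; rewrite addFb addTb.
  case: (a) (b) => -[] f0 f1 ub wrong /=.
  - by rewrite (wrong t0 t1) // addr0.
  - by rewrite (wrong t1 t0) // ?add0r // addrC.
  - by rewrite (wrong t1 t0) // ?add0r // addrC.
  - by rewrite (wrong t0 t1) // addr0.
have f'_bij : bijective f' by exists f.
(* An odd generator leads to the parity shift, an even one to the module itself. *)
case: (a) f'_comp => f'_comp; [right | left]; exists (linear_pack f'_lin); split=> //.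
- by move=> b u /f'_comp; rewrite addbT.
- by move=> b u /f'_comp; rewrite addbF.
Qed.
End Classification.
End Bland.

(** Over a [realType], [R[i]] is the field of complex numbers. The bijection is expressed as
    well-definedness, injectivity and surjectivity on classes, with extensions compared as
    functions. *)
Theorem theorem3p6 (R : realType) (g : lieSuperalgebra R[i])
    (p : gradedIdeal g) (phi : lsaHom p (scalar_lsa R[i])) :
  ((exists V : supermodule g, bland phi V) <-> extendable phi) /\
  (extendable phi ->
    [/\ forall phi' : extension phi, bland phi (Vind phi'),
        forall phi1 phi2 : extension phi,
          iso_upto_parity (Vind phi1) (Vind phi2) -> phi1 =1 phi2
      & forall V : supermodule g, bland phi V ->
          exists phi' : extension phi, iso_upto_parity V (Vind phi')]).
Proof.
split; first split.
- by case=> V /bland_extension [phi' _]; exists phi'; exact: extension_extends.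
- by case=> phi' ext; exists (Vind (Extension ext)); exact: bland_Vind.
- move=> _; split; first exact: bland_Vind.
    exact: iso_upto_parity_Vind_inj.
  exact: bland_classification.
Qed.
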